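(* Let $\alpha_1,\ldots,\alpha_m$ be nonzero pairwise distinct real numbers. Let $1<p_1,\ldots,p_m,r<\infty$ satisfy $$1<\sum_{i=1}^m \frac1{p_i}+\frac1r<2,$$ and define $1<p<\infty$ by $$\frac1p=\sum_{i=1}^m \frac1{p_i}+\frac1r-1.$$ Let $0<q_1,\ldots,q_m,s\leq\infty$, and define $0<q\leq\infty$ by $$\frac1q=\sum_{i=1}^m \frac1{q_i}+\frac1s.$$ Then there exists a positive constant $C=C(n,m,\alpha_1,\ldots,\alpha_m,p_1,\ldots,p_m,r,q_1,\ldots,q_m,s)$ such that $$\big\|T_g(f_1,\ldots,f_m)\big\|_{p,q}\leq C\Big(\prod_{i=1}^m \|f_i\|_{p_i,q_i}\Big)\|g\|_{r,s}$$ for all $f_i\in L^{p_i,q_i}(\mathbb{R}^n)$, $i=1,\ldots,m$, and all $g\in L^{r,s}(\mathbb{R}^n)$.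
   Context: Here $n,m$ are positive integers and $1/\infty=0$. For a measurable function $f$ on a Euclidean space, $f^*(t)=\inf\{\lambda\ge 0: |\{|f|>\lambda\}|\le t\}$ is its decreasing rearrangement. For $0<p<\infty$, set $\|f\|_{p,q}=\left(\int_0^\infty (t^{1/p}f^*(t))^q\,\frac{dt}{t}\right)^{1/q}$ if $0<q<\infty$ and $\|f\|_{p,\infty}=\sup_{t>0}t^{1/p}f^*(t)$. The Lorentz space $L^{p,q}$ consists of all measurable $f$ with $\|f\|_{p,q}<\infty$. For measurable functions $f_1,\ldots,f_m,g$ on $\mathbb{R}^n$, the one-parameter multilinear convolution operator is $$T_g(f_1,\ldots,f_m)(x)=\int_{\mathbb{R}^n}\Big(\prod_{i=1}^m f_i(x-\alpha_i y)\Big)g(y)\,dy,$$ defined at those $x$ where the integral converges absolutely. For nonnegative functions it is well defined with values in $[0,\infty]$. Since $|T_g(f_1,\ldots,f_m)|\le T_{|g|}(|f_1|,\ldots,|f_m|)$, one uses the standard reduction to nonnegative functions and kernels. *)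

(* Defs.v *)
From HB Require Import structures.
From mathcomp Require Import all_boot all_order all_algebra.
From mathcomp Require Import all_classical all_reals all_analysis.
From mathcomp Require Import complex.

Set Implicit Arguments.
Unset Strict Implicit.
Unset Printing Implicit Defensive.

Import Order.TTheory GRing.Theory Num.Theory.
Import numFieldNormedType.Exports.

Local Open Scope classical_set_scope.
Local Open Scope ring_scope.

Section product_lebesgue.
Context {R : realType}.

Definition cons_pair n (z : n.-tuple R * R) : n.+1.-tuple R :=
  [tuple of z.2 :: z.1].

Lemma measurable_cons_pair n : measurable_fun setT (@cons_pair n).
Proof. exact: measurable_cons. Qed.

Definition product_lebesgue_step n (mu : set (n.-tuple R) -> \bar R) :
    set (n.+1.-tuple R) -> \bar R :=
  pushforward (mu \x @lebesgue_measure R)%E (@cons_pair n).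

HB.instance Definition _ n (mu : {measure set (n.-tuple R) -> \bar R}) :=
  Measure.copy (product_lebesgue_step mu)
  (measure_function_pushforward__canonical__measure_function_Measure
    (mu \x @lebesgue_measure R)%E (@measurable_cons_pair n)).

Fixpoint product_lebesgue n : {measure set (n.-tuple R) -> \bar R} :=
  if n is k.+1 then product_lebesgue_step (product_lebesgue k)
  else \d_[tuple].

End product_lebesgue.
Arguments product_lebesgue : clear implicits.

(** Points of R^n are [n.-tuple R].  [product_lebesgue R n] is the n-fold
    product of the one-dimensional Lebesgue measure, on the product (Borel)
    sigma-algebra.  [euclidean R n] carries the Lebesgue measurable sets, i.e.
    the Caratheodory sets of the outer measure generated by
    [product_lebesgue R n], and [lebesgue_n R n] is the completed measure. *)
Definition euclidean (R : realType) (n : nat) : measurableType _ :=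
  caratheodory_type (product_lebesgue R n)^*%mu.

Definition lebesgue_n (R : realType) (n : nat) :
    set (euclidean R n) -> \bar R :=
  @completed_measure_extension _ _ _ (product_lebesgue R n).

HB.instance Definition _ (R : realType) (n : nat) :=
  Measure.on (@lebesgue_n R n).
Arguments lebesgue_n : clear implicits.

(** The point [x - a y]. *)
Definition subscale (R : realType) (n : nat) (a : R)
    (x y : euclidean R n) : euclidean R n :=
  [tuple tnth x j - a * tnth y j | j < n].

Section complex_functions.
Context {d : measure_display} {T : measurableType d} {R : realType}.
Variable mu : {measure set T -> \bar R}.
Implicit Types f : T -> R[i].

Definition cmeasurable f : Prop :=
  measurable_fun setT (fun x => complex.Re (f x)) /\
  measurable_fun setT (fun x => complex.Im (f x)).

Definition cintegrable f : Prop :=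
  cmeasurable f /\ (\int[mu]_x (Normc.normc (f x))%:E < +oo)%E.

(** A junk value unless [cintegrable f]. *)
Definition cintegral f : R[i] :=
  Complex (\int[mu]_x complex.Re (f x)) (\int[mu]_x complex.Im (f x)).

(** Decreasing rearrangement [f^*]; it is [+oo] at [t] when no level [l]
    qualifies. *)
Definition rearrangement f (t : R) : \bar R :=
  ereal_inf [set l%:E | l in
    [set l : R | 0 <= l /\ (mu [set x | (l < Normc.normc (f x))%R] <= t%:E)%E]].

(** The case [q = -oo] is irrelevant: exponents satisfy [0 < q]. *)
Definition lorentz_norm (p : R) (q : \bar R) f : \bar R :=
  (match q with
   | q'%:E => (\int[@lebesgue_measure R]_(t in `]0%R, +oo[)
       (((t `^ p^-1)%R%:E * rearrangement f t) `^ q' * (t^-1)%R%:E)) `^ q'^-1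
   | +oo => ereal_sup [set (t `^ p^-1)%R%:E * rearrangement f t
                      | t in [set t : R | (0 < t)%R]]
   | -oo => 0
   end)%E.

Definition lorentz (p : R) (q : \bar R) f : Prop :=
  cmeasurable f /\ (lorentz_norm p q f < +oo)%E.

End complex_functions.

Section multilinear_convolution.
Context {R : realType} {n m : nat}.
Variables (alpha : 'I_m -> R) (f : 'I_m -> euclidean R n -> R[i]).
Variable g : euclidean R n -> R[i].

Definition mconv_integrand (x y : euclidean R n) : R[i] :=
  (\prod_(i < m) f i (subscale (alpha i) x y)) * g y.

Definition mconv (x : euclidean R n) : R[i] :=
  cintegral (lebesgue_n R n) (mconv_integrand x).

End multilinear_convolution.

(* Main.v *)
Require Import Defs.
From HB Require Import structures.
From mathcomp Require Import all_boot all_order all_algebra.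
From mathcomp Require Import all_classical all_reals all_analysis measurable_realfun.
From mathcomp Require Import complex ring lra.

(** Write the forms as L_i(x, y) = x - alpha_i y and L_0(x, y) = y, and give the
    kernel g the index 0.  Because the alpha_i are nonzero and pairwise distinct,
    any two of these forms are linearly independent, and each of them is a
    nondegenerate affine map of y when x is fixed.  For indicators of sets E_j
    this yields two bounds for T(x), the integral over y of the product of the
    1_{E_j}(L_j(x, y)): T is at most K min |E_j| everywhere, and the integral of
    T is at most K |E_i| |E_j| for every pair i <> j ([conv_form_section] and
    [conv_form_pair]).  Everything else is a summation argument that knows the
    forms only through these two bounds.

    Fix t > 0 and cut each factor into layers: if the rearrangement of the j-th
    factor at 2^k t is at most beta_{j,k} for all integers k, then the j-th factor
    is dominated by the sum over k of beta_{j,k} 1_{E_{j,k}} with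
    |E_{j,k}| <= 2^(k+1) t.  Expanding the product gives a sum over multi-indices
    kappa of restricted terms, each of which is either bounded or integrable with
    an explicit constant; Chebyshev's inequality applied to the integrable terms
    alone shows that these constants add up ([superposition_level]).  Let theta_j
    be the reciprocal exponents of the factors, and add one more index, for the
    output, with weight theta = 1 - 1/p and kappa = 0.  The relation between the
    exponents says that all the weights sum to 2, and each lies strictly between
    0 and 1.  Then some two indices i <> j satisfy
    kappa_i + kappa_j - sum theta_l kappa_l <= - eps max |kappa_l|
    ([spread_pair]).  So the constants decay geometrically in every kappa_l
    separately, and there is room to let beta_{j,k} exceed the natural size
    (2^k t)^(-theta_j) by B_j 2^(delta |k|).  The outcome, [multilinear_level], is
    that the rearrangement of T(f_1, ..., f_m) at t is at most
    C t^(-1/p) times the product of the B_j.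

    It remains to choose B_j = B_j(t).  With b(t) = t^(1/p) f^*(t), a
    finite Lorentz norm allows
    B(t)^q = sum_n 2^(-delta q n) (b(2^n t)^q + b(2^(-n) t)^q),
    and since dt/t is invariant under dilations the L^q(dt/t) norm of B is at most
    a constant times the Lorentz norm of f, whatever q > 0, since it is q-th powers
    that are summed ([lorentz_majorant]).  Holder's inequality in L^q(dt/t), in the form
    of the weighted arithmetic-geometric mean inequality, then gives the theorem
    ([lorentz_norm_product_le]).

    Lebesgue measurable factors are replaced by Borel ones that agree with them
    off a null set; as every L_j(x, .) pulls null sets back to null sets, this
    changes none of the integrals defining the operator ([mconv_borel]). *)

Set Implicit Arguments.
Unset Strict Implicit.
Unset Printing Implicit Defensive.

Import Order.TTheory GRing.Theory Num.Theory.
Import numFieldNormedType.Exports.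

Local Open Scope classical_set_scope.
Local Open Scope ring_scope.

(** * Auxiliary facts on reals, finite families and measures *)

Section preliminaries.
Context {R : realType}.

Lemma expr_eventually_lt (x v : R) : 0 <= x -> x < 1 -> 0 < v -> exists N, x ^+ N < v.
Proof.
move=> x0 x1 v0; have : `|x| < 1 by rewrite ger0_norm.
move=> /cvg_expr /cvgrPdist_lt /(_ _ v0)[N _ /(_ N (leqnn N))].
by rewrite /= sub0r normrN ger0_norm ?exprn_ge0// => ?; exists N.
Qed.

(** A discrete intermediate value property: the layer of a value v is the last
    step at which s is still at least v. *)
Lemma crossing (s : nat -> R) (M : nat) (v : R) : s M < v -> v <= s 0%N ->
  exists i, [/\ (i < M)%N, s i.+1 < v & v <= s i].
Proof.
elim: M => [|M IH] sM v0; first by move: (lt_le_trans sM v0); rewrite ltxx.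
have [/IH /(_ v0)[i [iM ? ?]]|vM] := ltP (s M) v; last by exists M.
by exists i; split => //; exact: ltnW.
Qed.

Lemma sum_geometric_le (x : R) n : 0 <= x -> x < 1 -> \sum_(i < n) x ^+ i <= (1 - x)^-1.
Proof.
move=> x0 x1; have d0 : 0 < 1 - x by lra.
rewrite -(ler_pM2l d0) mulfV ?gt_eqF//.
have := subrX1 x n; have := exprn_ge0 n x0; set S := \sum_(i < n) _; lra.
Qed.

Lemma prod_powR (I : finType) (x : R) (a : I -> R) : 0 < x ->
  \prod_i x `^ a i = x `^ (\sum_i a i).
Proof.
move=> x0; apply/esym/(big_morph (powR x)); last exact: powRr0.
by move=> u v; rewrite powRD// (gt_eqF x0) implybT.
Qed.

Lemma powR_prod (J : finType) (x : J -> R) (q : R) : (forall j, 0 <= x j) ->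
  (\prod_j x j) `^ q = \prod_j x j `^ q.
Proof.
move=> x0; suff [] : 0 <= \prod_j x j /\ (\prod_j x j) `^ q = \prod_j x j `^ q by [].
apply: (big_ind2 (fun a b => 0 <= a /\ a `^ q = b)) => [|a b a' b' [a0 <-] [a'0 <-]|//].
  by rewrite powR1.
by rewrite mulr_ge0// powRM.
Qed.

End preliminaries.

Lemma big_option (V : Type) (idx : V) (op : Monoid.com_law idx) (I : finType)
    (F : option I -> V) :
  \big[op/idx]_i F i = op (F None) (\big[op/idx]_i F (Some i)).
Proof.
rewrite (bigD1 None)//=; congr (op _ _).
rewrite (reindex_omap Some id) => [|[i|]]//=.
by apply: eq_bigl => i; rewrite eqxx.
Qed.

Lemma finite_lower_bound (R : realType) (I : finType) (F : I -> R) :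
  (forall i, 0 < F i) -> exists e, 0 < e /\ forall i, e <= F i.
Proof.
move=> F0; exists (\big[Order.min/1]_i F i); split; last by move=> i; exact: bigmin_le.
by apply/bigmin_gtP.
Qed.

Lemma measurable_superlevel d (T : measurableType d) (R : realType) (u : T -> R) (b : R) :
  measurable_fun setT u -> measurable [set x | b < u x].
Proof. by move=> mu; rewrite -preimage_itvoy -[X in measurable X]setTI; exact: mu. Qed.

Lemma measure_bigcup_le d (T : measurableType d) (R : realType) (mu : {measure set T -> \bar R})
    (F : (set T)^nat) (a : \bar R) :
  (forall n, measurable (F n)) -> nondecreasing_seq F ->
  (forall n, (mu (F n) <= a)%E) -> (mu (\bigcup_n F n) <= a)%E.
Proof.
move=> mF ndF Fa.
have H := @nondecreasing_cvg_mu _ _ _ mu _ mF (bigcupT_measurable _ mF) ndF.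
by rewrite -(cvg_lim _ H)//; apply: lime_le; [apply/cvg_ex; eexists; exact: H|exact: nearW].
Qed.

(** * Affine maps and Lebesgue measure *)

Section affine_line.
Context {R : realType}.
Notation lambda := (@lebesgue_measure R).

Lemma measurable_affine_line (a b : R) :
  measurable_fun setT (fun t : measurableTypeR R => b + a * t : measurableTypeR R).
Proof. by apply: measurable_funD => //; exact: mulrl_measurable. Qed.

(** Both sides, as functions of E, are measures up to the factor |a|; they agree
    on half-open intervals, hence on Borel sets. *)
Lemma lebesgue_measure_affine (a b : R) (E : set (measurableTypeR R)) :
  a != 0 -> measurable E ->
  lambda ((fun t : measurableTypeR R => b + a * t : measurableTypeR R) @^-1` E)
    = ((`|a|^-1)%:E * lambda E)%E.
Proof.
move=> a0 mE.
pose phi : measurableTypeR R -> measurableTypeR R := fun t => b + a * t.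
have mphi : measurable_fun setT phi by exact: measurable_affine_line.
have na0 : (0 < `|a|)%R by rewrite normr_gt0.
pose push : {measure set (measurableTypeR R) -> \bar R} :=
  measure_function_pushforward__canonical__measure_function_Measure lambda mphi.
pose nu : {measure set (measurableTypeR R) -> \bar R} :=
  mscale (NngNum (ltW na0)) push.
have H : lambda E = nu E.
  apply: lebesgue_measure_unique => // _ [[x y]] _ <- /=.
  rewrite /mscale /pushforward /= /phi lebesgue_measure_itv /= lte_fin.
  have [agt0|alt0] := ltP 0 a.
    rewrite [pushforward _ _ _](_ : _ = lambda `]((x - b) / a), ((y - b) / a)]%classic).
      rewrite lebesgue_measure_itv /= lte_fin ltr_pM2r ?invr_gt0// ltrD2r.
      case: ifPn => _; last by rewrite mule0.
      by rewrite -!EFinB -EFinM gtr0_norm//; congr EFin; field.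
    congr (lambda _); apply/seteqP; split => t /=; rewrite !in_itv /= => /andP[];
      rewrite ?(ltr_pdivrMr,ler_pdivlMr)// => ? ?; apply/andP; split; lra.
  have {}alt0 : a < 0 by rewrite lt_neqAle a0.
  rewrite [pushforward _ _ _](_ : _ = lambda `[((y - b) / a), ((x - b) / a)[%classic).
    rewrite lebesgue_measure_itv /= lte_fin ltr_nM2r ?invr_lt0// ltrD2r.
    case: ifPn => _; last by rewrite mule0.
    by rewrite -!EFinB -EFinM ltr0_norm//; congr EFin; field.
  congr (lambda _); apply/seteqP; split => t /=; rewrite !in_itv /= => /andP[];
    rewrite ?(ltr_ndivlMr,ler_ndivrMr)// => ? ?; apply/andP; split; lra.
rewrite H /= /mscale /= /pushforward /= muleA -EFinM mulVf ?mul1e//.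
by rewrite gt_eqF.
Qed.
End affine_line.

Section tuple_lebesgue.
Context {R : realType}.

(** The measure [product_lebesgue R n] under a name of its own, to which the
    sigma-finite structure required by Tonelli's theorem can be attached. *)
Definition tuple_lebesgue (n : nat) : set (n.-tuple R) -> \bar R :=
  product_lebesgue R n.

HB.instance Definition _ n := Measure.on (@tuple_lebesgue n).

Lemma sigma_finite_tuple_lebesgue n : sigma_finite setT (@tuple_lebesgue n).
Proof.
elim: n => [|n /sigma_finiteP[F [FT Fnd mF]]].
  exists (fun=> setT); first by rewrite bigcup_const.
  by move=> k; split => //; rewrite /tuple_lebesgue /= diracT ltry.
have /sigma_finiteP[G [GT Gnd mG]] := sigma_finiteT (@lebesgue_measure R).
pose S k l := [set t : n.+1.-tuple R | F k [tuple of behead t] /\ G l (thead t)].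
have mS k l : measurable (S k l).
  apply: measurableI.
    by rewrite -[X in measurable X]setTI; apply: measurable_behead => //;
      exact: (mF k).1.
  by rewrite -[X in measurable X]setTI; apply: measurable_tnth => //; exact: (mG l).1.
have SE k l : tuple_lebesgue (S k l) = (tuple_lebesgue (F k) * lebesgue_measure (G l))%E.
  rewrite /tuple_lebesgue /= /product_lebesgue_step /pushforward.
  rewrite -product_measure1E//; [|exact: (mF k).1|exact: (mG l).1].
  congr (_ _); apply/seteqP; split => -[u v] /=.
    by move=> [/= +]; rewrite /cons_pair /= theadE (_ : [tuple of _] = u) //;
      apply: val_inj.
  by move=> [Fu Gv]; split; rewrite /= ?theadE// (_ : [tuple of _] = u) //; apply: val_inj.
exists (fun k => S k k); last first.
  move=> k; have [_ Fk] := mF k; have [_ Gk] := mG k.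
  by split=> //; rewrite SE lte_mul_pinfty// ge0_fin_numE.
apply/seteqP; split => // t _.
have [k _ Fk] : (\bigcup_i F i) [tuple of behead t] by rewrite -FT.
have [l _ Gl] : (\bigcup_i G i) (thead t) by rewrite -GT.
exists (maxn k l) => //; split.
- by move: Fk; exact/subsetPset/Fnd/leq_maxl.
- by move: Gl; exact/subsetPset/Gnd/leq_maxr.
Qed.
HB.instance Definition _ n := @Measure_isSigmaFinite.Build _ _ _
  (@tuple_lebesgue n) (@sigma_finite_tuple_lebesgue n).

Definition affine n (a : R) (b z : n.-tuple R) : n.-tuple R :=
  [tuple tnth b j + a * tnth z j | j < n].

Lemma measurable_affine n (a : R) (b : n.-tuple R) :
  measurable_fun setT (affine a b).
Proof.
apply/measurable_fun_tnthP => i; rewrite (_ : _ \o _ = (fun z => tnth b i + a * tnth z i)).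
  apply: measurable_funD => //; apply: measurable_funM => //; exact: measurable_tnth.
by apply/funext => z /=; rewrite tnth_mktuple.
Qed.

(** By induction on the dimension: an affine map of this kind acts separately on
    the first coordinate and on the others, so its pushforward, renormalised by
    |a|^(n+1), has the right values on rectangles. *)
Lemma tuple_lebesgue_affine n (a : R) (b : n.-tuple R) (E : set (n.-tuple R)) :
  a != 0 -> measurable E ->
  tuple_lebesgue (affine a b @^-1` E) = ((`|a|^-1 ^+ n)%:E * tuple_lebesgue E)%E.
Proof.
move=> a0; have na0 : 0 < `|a| by rewrite normr_gt0.
elim: n b E => [|n IH] b E mE.
  rewrite expr0 mul1e (_ : affine a b = id) ?preimage_id//.
  by apply/funext => z; rewrite [LHS]tuple0 [RHS]tuple0.
pose psi (z : n.-tuple R * measurableTypeR R) : n.-tuple R * measurableTypeR R :=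
  (affine a [tuple of behead b] z.1, thead b + a * z.2).
have mpsi : measurable_fun setT psi.
  apply/measurable_fun_pairP; split.
    exact: (measurableT_comp (measurable_affine a [tuple of behead b])).
  by apply: measurable_funD => //; exact: measurable_funM.
have cons_psi z : cons_pair (psi z) = affine a b (cons_pair z).
  apply/eq_from_tnth => i; rewrite tnth_mktuple /cons_pair.
  have [j ->|->] := unliftP ord0 i; last by rewrite !tnth0.
  rewrite !tnthS tnth_mktuple tnth_behead (_ : inord _ = lift ord0 j)//.
  by apply: val_inj; rewrite /= inordK// ltnS.
pose push : {measure set (n.-tuple R * measurableTypeR R) -> \bar R} :=
  measure_function_pushforward__canonical__measure_function_Measure
    (@tuple_lebesgue n \x @lebesgue_measure R)%E mpsi.
have aK : `|a| ^+ n.+1 * `|a|^-1 ^+ n.+1 = 1.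
  by rewrite -exprMn mulfV ?expr1n// gt_eqF.
pose c : {nonneg R} := NngNum (exprn_ge0 n.+1 (ltW na0)).
pose nu : {measure set (n.-tuple R * measurableTypeR R) -> \bar R} := mscale c push.
have mcE : measurable (@cons_pair R n @^-1` E).
  by rewrite -[X in measurable X]setTI; exact: measurable_cons_pair.
have nuE : (@tuple_lebesgue n \x @lebesgue_measure R)%E (@cons_pair R n @^-1` E) =
    nu (@cons_pair R n @^-1` E).
  apply: product_measure_unique => // A B mA mB.
  rewrite /nu /= /mscale /= /push /pushforward.
  rewrite (_ : psi @^-1` (A `*` B) = (affine a [tuple of behead b] @^-1` A) `*`
    ((fun t : measurableTypeR R => thead b + a * t : measurableTypeR R) @^-1` B)); last by [].
  rewrite product_measure1E//; last 2 first.
  - by rewrite -[X in measurable X]setTI; exact: measurable_affine.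
  - by rewrite -[X in measurable X]setTI; exact: measurable_affine_line.
  rewrite [X in (_ * (X * _))%E](IH [tuple of behead b] A mA).
  rewrite [X in (_ * (_ * X))%E](lebesgue_measure_affine _ a0 mB) muleACA.
  by rewrite [LHS]muleA -!EFinM -exprSr [X in (X%:E * _)%E]aK mul1e.
transitivity ((@tuple_lebesgue n \x @lebesgue_measure R)%E
    (psi @^-1` (@cons_pair R n @^-1` E))).
  rewrite {1}/tuple_lebesgue /= /product_lebesgue_step /pushforward; congr (_ _).
  by apply/seteqP; split => z /=; rewrite cons_psi.
rewrite [RHS](_ : _ = (`|a|^-1 ^+ n.+1)%:E * nu (@cons_pair R n @^-1` E))%E; last first.
  by rewrite -nuE.
rewrite /nu /= /mscale /= muleA -EFinM mulrC [X in (X%:E * _)%E](_ : _ = 1) ?mul1e//.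
Qed.
End tuple_lebesgue.

(** * Borel representatives of Lebesgue measurable functions *)

Section completion.
Local Open Scope ereal_scope.
Context d (T : measurableType d) (R : realType).
Variable mu : {measure set T -> \bar R}.
Hypothesis sfmu : sigma_finite setT mu.
Notation C := (caratheodory_type (mu^*)%mu).
Notation cmu := (@completed_measure_extension _ T R mu).

Lemma measurable_completed (E : set T) : measurable E -> measurable (E : set C).
Proof. exact: caratheodory_measurable_mu_ext. Qed.

Lemma completedE (E : set T) : measurable E -> cmu E = mu E.
Proof. exact: measurable_mu_extE. Qed.

(** Intersect countably many covers of X whose measures approach the outer
    measure of X; if the latter is infinite, the whole space will do. *)
Lemma measurable_hull (X : set T) :
  exists F, [/\ measurable F, X `<=` F & cmu X = mu F].
Proof.
have [Xoo|Xfin] := eqVneq (cmu X) +oo.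
  exists setT; split => //; rewrite Xoo; apply/esym/eqP.
  rewrite -leye_eq -Xoo.
  by rewrite -completedE//; exact: le_mu_ext.
have Xge0 : 0 <= cmu X by exact: mu_ext_ge0.
have {Xfin}Xnum : cmu X \is a fin_num by rewrite ge0_fin_numE// lt_neqAle Xfin leey.
have cover (n : nat) : exists F, [/\ measurable F, X `<=` F &
    mu F <= cmu X + (n.+1%:R^-1)%:E].
  have e0 : (0 < n.+1%:R^-1 :> R)%R by rewrite invr_gt0.
  have [_ /= [A [mA XA] <-] AX] := lb_ereal_inf_adherent e0 Xnum.
  exists (\bigcup_k A k); split => //; first exact: bigcupT_measurable.
  apply/ltW; apply: le_lt_trans AX.
  by apply: measure_sigma_subadditive => //; exact: bigcupT_measurable.
have [F HF] := choice cover.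
have mF k : measurable (F k) by have [] := HF k.
exists (\bigcap_k F k); split.
- exact: bigcapT_measurable.
- by apply: sub_bigcap => k _; have [] := HF k.
have mcap : measurable (\bigcap_k F k) by exact: bigcapT_measurable.
apply/eqP; rewrite eq_le; apply/andP; split.
  rewrite -[leRHS]completedE//; apply: le_mu_ext.
  by apply: sub_bigcap => k _; have [] := HF k.
apply/lee_addgt0Pr => _/posnumP[e]; near \oo => n.
have [_ _ FX] := HF n.
apply: (@le_trans _ _ (mu (F n))).
  by apply: le_measure; rewrite ?inE//; exact: bigcap_inf.
apply: (le_trans FX); rewrite leeD2l// lee_fin ltW//.
by near: n; exact: near_infty_natSinv_lt.
Unshelve. all: by end_near. Qed.

(** On a piece of finite measure, E lies in a hull F with F minus E of measure zero,
    and a null hull G of that difference gives E minus G = F minus G.  Sigma-finiteness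
    glues countably many such pieces. *)
Lemma completed_measurable_core (E : set C) : measurable E ->
  exists N : set T, [/\ measurable N, mu N = 0 & measurable (E `\` N : set T)].
Proof.
move=> mE.
have /sigma_finiteP[S [ST Snd mS]] := sfmu.
have piece (i : nat) : exists N : set T,
    [/\ measurable N, mu N = 0 & measurable ((E `&` S i) `\` N : set T)].
  have mES : measurable (E `&` S i : set C).
    by apply: measurableI => //; apply: measurable_completed; exact: (mS i).1.
  have ESfin : cmu (E `&` S i) < +oo.
    apply: (@le_lt_trans _ _ (cmu (S i))); first (apply: le_mu_ext; exact: subIsetr).
    by rewrite completedE; have [] := mS i.
  have [F [mF EF EFE]] := measurable_hull (E `&` S i).
  have mFC := measurable_completed mF.
  have FE0 : cmu (F `\` (E `&` S i)) = 0.
    rewrite measureD//=.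
    + by rewrite setIidr// completedE// EFE subee// ge0_fin_numE// -EFE; exact: ESfin.
    + by rewrite completedE// -EFE; exact: ESfin.
  have [G [mG FEG GFE]] := measurable_hull (F `\` (E `&` S i)).
  exists G; split => //; first by rewrite -GFE.
  rewrite (_ : _ `\` G = F `\` G); first exact: measurableD.
  apply/seteqP; split => x [xE xG]; split => //; first exact: EF.
  by apply: contrapT => nxE; apply: xG; apply: FEG.
have [N HN] := choice piece.
have mN i : measurable (N i) by have [] := HN i.
exists (\bigcup_i N i); split; first exact: bigcupT_measurable.
  apply: measure_negligible; first exact: bigcupT_measurable.
  by apply: negligible_bigcup => k; apply/negligibleP => //; have [] := HN k.
rewrite (_ : _ `\` _ = \bigcup_i (((E `&` S i) `\` N i) `\` \bigcup_j N j)).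
  apply: bigcupT_measurable => i; apply: measurableD; first by have [] := HN i.
  exact: bigcupT_measurable.
apply/seteqP; split => [x [Ex nNx]|x [i _ [[[Ex _] _] nNx]]]; last by split.
have [i _ Six] : (\bigcup_i S i) x by rewrite -ST.
by exists i => //; split => //; split => // Nix; apply: nNx; exists i.
Qed.

(** It suffices to treat the superlevel sets at rational heights, and countably
    many null sets have a null union.  Off that union the function is Borel;
    setting it to zero there keeps it so. *)
Lemma completed_measurable_fun_core (f : C -> R) : measurable_fun setT f ->
  exists N : set T, [/\ measurable N, mu N = 0 &
    measurable_fun setT (f \_ (~` N) : T -> R)].
Proof.
move=> mf.
have level (q : rat) : exists N : set T, [/\ measurable N, mu N = 0 &
    measurable ([set x | (ratr q < f x)%R] `\` N : set T)].
  apply: completed_measurable_core; rewrite -preimage_itvoy -[X in measurable X]setTI.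
  exact: mf.
have [N HN] := choice level.
have mN q : measurable (N q) by have [] := HN q.
(* the rationals are enumerated so as to take a countable union over nat *)
pose M := \bigcup_k N (odflt 0%R (unpickle k)).
have mM : measurable M by exact: bigcupT_measurable.
have NM q : N q `<=` M by move=> x Nx; exists (pickle q) => //; rewrite pickleK.
exists M; split => //.
  apply: measure_negligible => //; apply: negligible_bigcup => k.
  by apply/negligibleP => //; have [] := HN (odflt 0%R (unpickle k)).
apply: (measurability _ (RGenOInfty.measurableE R)) => //.
move=> /= _ [_ [a ->] <-]; rewrite setTI preimage_itvoy.
rewrite (_ : [set x | _] = \bigcup_(q in [set q : rat | (a < ratr q)%R])
   (([set x | (ratr q < f x)%R] `\` N q `\` M)
    `|` (if (ratr q < 0 :> R)%R then M else set0))).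
  rewrite bigcup_mkcond; apply: bigcupT_measurable_rat => q; case: ifPn => // _.
  apply: measurableU; last by case: ifPn.
  by apply: measurableD => //; have [] := HN q.
apply/seteqP; split => x /=; rewrite /patch.
  case: ifPn => [|]; rewrite ?inE ?notin_setE /= => Mx.
    move=> /rat_in_itvoo[q]; rewrite in_itv /= => /andP[aq qf].
    by exists q => //; left; split => //; split => // /NM.
  move=> /rat_in_itvoo[q]; rewrite in_itv /= => /andP[aq qf].
  by exists q => //; right; rewrite qf; exact: contrapT.
move=> [q /= aq [[[qf Nq] Mx]|]].
  by rewrite mem_set//; exact: lt_trans qf.
case: ifPn => // q0 Mx; rewrite memNset; last by apply.
exact: lt_trans q0.
Qed.

Lemma ae_completed_measurable_fun (N : set T) (f g : T -> R) :
  measurable N -> mu N = 0 -> (forall x, ~ N x -> f x = g x) ->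
  measurable_fun setT f -> measurable_fun setT (g : C -> R).
Proof.
move=> mN N0 fg mf; apply/measurable_EFinP.
apply: (@ae_measurable_fun _ _ _ cmu _ _ (EFin \o (f : C -> R))).
- exact: measure_is_complete_caratheodory.
- exists N; split => //; first exact: measurable_completed.
    by rewrite -[RHS]N0; exact: completedE.
  by move=> x /= /not_implyP[_]; apply: contra_notP => /fg ->.
- apply/measurable_EFinP => _ B mB; apply: measurable_completed; exact: mf.
Qed.

Lemma measurable_fun_completed d' (T' : measurableType d') (f : T -> T') :
  measurable_fun setT f -> measurable_fun setT (f : C -> T').
Proof. by move=> mf _ B mB; apply: measurable_completed; exact: mf. Qed.

Lemma ge0_integral_completed (f : T -> \bar R) :
  measurable_fun setT f -> (forall x, 0 <= f x) ->
  \int[cmu]_x f x = \int[mu]_x f x.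
Proof.
move=> mf f0.
have mid : measurable_fun setT (id : C -> T) by exact: measurable_fun_completed.
rewrite -[LHS](@ge0_integral_pushforward _ _ C T R _ mid cmu setT)//.
by apply: eq_measure_integral => A mA _; exact: completedE.
Qed.

End completion.

(** * Superposition of restricted estimates *)

Section superposition.
Local Open Scope ereal_scope.
Context d (T : measurableType d) (R : realType).
Variable mu : {measure set T -> \bar R}.

(** The key to adding weak-type estimates without loss.  The terms bounded by
    c_k cannot contribute more than their sum of c_k, so the sum of the remaining
    terms has to exceed its own sum S of c_k; as its integral is at most t S, this
    happens on a set of measure at most t. *)
Lemma superposition_level (I : finType) (U : I -> T -> \bar R) (c : I -> R) (t : R) :
  (0 < t)%R -> (forall k, measurable_fun setT (U k)) ->
  (forall k x, 0 <= U k x) -> (forall k, (0 <= c k)%R) ->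
  (forall k, (forall x, U k x <= (c k)%:E) \/
     \int[mu]_x U k x <= (t * c k)%:E) ->
  mu [set x | (\sum_k c k)%:E < \sum_k U k x] <= t%:E.
Proof.
move=> t0 mU U0 c0 Uc.
(* D selects the terms bounded pointwise; G and s keep only the others *)
pose D k := `[< forall x, U k x <= (c k)%:E >].
pose G k x := if D k then 0 else U k x.
pose s k := if D k then 0%R else c k.
have G0 k x : 0 <= G k x by rewrite /G; case: ifP.
have mG k : measurable_fun setT (G k) by rewrite /G; case: (D k).
pose GG x := \sum_k G k x; pose S := (\sum_k s k)%R.
have GG0 x : 0 <= GG x by exact: sume_ge0.
have S0 : (0 <= S)%R by apply: sumr_ge0 => k _; rewrite /s; case: ifP.
have mGG : measurable_fun setT GG by exact: emeasurable_sum.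
have intG : \int[mu]_x GG x <= t%:E * S%:E.
  rewrite /GG ge0_integral_sum// -EFinM mulr_sumr -sumEFin.
  apply: lee_sum => k _; rewrite /G /s; case: ifP => [Dk|/asboolPn nDk].
    by rewrite integral0 mulr0.
  by case: (Uc k) => // /nDk.
have sub : [set x | (\sum_k c k)%:E < \sum_k U k x] `<=` [set x | S%:E < GG x].
  move=> x /=; apply: contraTT; rewrite -!leNgt => GS.
  rewrite -sumEFin [leRHS](eq_bigr (fun k => (if D k then (c k)%:E else 0) + (s k)%:E)); last first.
    by move=> k _; rewrite /s; case: (D k); rewrite -EFinD ?addr0 ?add0r.
  rewrite big_split /= sumEFin -/S.
  apply: (@le_trans _ _ (\sum_k (if D k then (c k)%:E else 0) + GG x)); last exact: leeD2l.
  rewrite -big_split /=; apply: lee_sum => k _; rewrite /G.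
  by case: ifPn => [/asboolP|_]; rewrite ?adde0 ?add0e.
have mlt : measurable [set x | S%:E < GG x].
  by rewrite -[X in measurable X]setTI; exact: emeasurable_fun_o_infty.
apply: (@le_trans _ _ (mu [set x | S%:E < GG x])).
  apply: le_measure; rewrite ?inE//.
  rewrite -[X in measurable X]setTI; apply: emeasurable_fun_o_infty => //.
  exact: emeasurable_sum.
have [Spos|Sle0] := ltP 0%R S; last first.
  have SE : S = 0%R by apply/eqP; rewrite eq_le Sle0 S0.
  have : \int[mu]_x `|GG x| = 0.
    under eq_integral do rewrite gee0_abs//.
    by apply/eqP; rewrite eq_le integral_ge0// andbT; move: intG; rewrite SE mule0.
  move=> /(ae_eq_integral_abs mu measurableT mGG) GG_ae.
  rewrite measure_negligible ?lee_fin ?ltW//.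
  apply: negligibleS GG_ae => x /=; rewrite SE => GGx /(_ Logic.I) /= GGx0.
  by move: GGx; rewrite GGx0 ltxx.
have := le_integral_abse mu measurableT mGG Spos.
under eq_integral do rewrite gee0_abs//.
move=> /le_trans /(_ intG); rewrite muleC lee_pmul2r ?lte_fin// => mk.
apply: le_trans mk; apply: le_measure; rewrite ?inE//.
  by apply: emeasurable_fun_c_infty => //; exact: measurableT_comp.
by move=> x /= /ltW; split => //=; rewrite gee0_abs.
Qed.
End superposition.

Section simple_core.
Local Open Scope ereal_scope.
Context d (T : measurableType d) (R : realType).
Variable mu : {sigma_finite_measure set T -> \bar R}.
Variables (J : finType) (L : J -> T -> T -> T) (K : R).
Hypothesis mL : forall j, measurable_fun setT (fun z : T * T => L j z.1 z.2).
Hypothesis K0 : (0 <= K)%R.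
Hypothesis L_section : forall j x E, measurable E ->
  mu (L j x @^-1` E) <= K%:E * mu E.
Hypothesis L_pair : forall i j E F, i != j -> measurable E -> measurable F ->
  \int[mu]_x mu (L i x @^-1` E `&` L j x @^-1` F) <= K%:E * mu E * mu F.

Let mLx j x : measurable_fun setT (L j x).
Proof. exact: (measurable_fun_pair2 _ (mL j)). Qed.

Let prod_indic_le (I : finType) (E : I -> set T) (v : I -> T) (S : set T) y :
  ((forall l, E l (v l)) -> S y) -> (\prod_l \1_(E l) (v l) <= \1_S y :> R)%R.
Proof.
move=> ES; have [/forallP inE_|/forallPn[l nl]] := boolP [forall l, v l \in E l].
  rewrite big1 => [|l _]; last by rewrite indicE inE_.
  by rewrite indicE mem_set//; apply: ES => l; apply/set_mem.
by rewrite (bigD1 l)//= indicE (negbTE nl) mul0r indicE ler0n.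
Qed.

Let integral_scaled_indic (P : R) (S : set T) : (0 <= P)%R -> measurable S ->
  \int[mu]_y (P * \1_S y)%:E = P%:E * mu S.
Proof.
move=> P0 mS; under eq_integral do rewrite EFinM.
rewrite ge0_integralZl//; first by rewrite integral_indic// setIT.
by apply/measurable_EFinP; exact: measurable_indic.
Qed.

(** Expanding the product of sums produces one restricted term for each choice k
    of a layer per factor.  The two alternatives for [c k] are those of
    [superposition_level]: the first bounds the term pointwise through one factor,
    the second bounds its integral through two factors. *)
Lemma multilinear_simple_level (W : finType) (E : J -> W -> set T)
    (b e : J -> W -> R) (c : {ffun J -> W} -> R) (t : R) :
  (0 < t)%R -> (forall j w, measurable (E j w)) ->
  (forall j w, (0 <= b j w)%R) ->
  (forall j w, (0 <= e j w)%R) ->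
  (forall j w, mu (E j w) <= (e j w)%:E) ->
  (forall k, (0 <= c k)%R) ->
  (forall k : {ffun J -> W},
    (exists j, (\prod_j b j (k j)) * (K * e j (k j)) <= c k)%R \/
    (exists i j, i != j /\
       (\prod_j b j (k j)) * (K * e i (k i) * e j (k j)) <= t * c k)%R) ->
  mu [set x | (\sum_k c k)%:E <
      \int[mu]_y (\prod_j \sum_w b j w * \1_(E j w) (L j x y))%:E] <= t%:E.
Proof.
move=> t0 mE b0 e0 mue c0 Hc.
pose u (k : {ffun J -> W}) (z : T * T) : R :=
  (\prod_j (b j (k j) * \1_(E j (k j)) (L j z.1 z.2)))%R.
have u0 k z : (0 <= u k z)%R by apply: prodr_ge0 => j _; rewrite mulr_ge0.
have uE k z : u k z = ((\prod_j b j (k j)) * \prod_j \1_(E j (k j)) (L j z.1 z.2))%R.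
  by rewrite /u big_split.
have mu_ k : measurable_fun setT (u k).
  apply: measurable_prod => j _; apply: measurable_funM => //.
  apply: (measurableT_comp (measurable_indic (mE j (k j)))); exact: mL.
pose U k x := \int[mu]_y (u k (x, y))%:E.
have mU k : measurable_fun setT (U k).
  apply: (@measurable_fun_fubini_tonelli_F _ _ _ _ _ mu (EFin \o u k)) => //.
    exact/measurable_EFinP.
  by move=> z; rewrite lee_fin.
have U0 k x : 0 <= U k x by apply: integral_ge0 => y _; rewrite lee_fin.
  have mpre j E' x : measurable E' -> measurable (L j x @^-1` E').
    by move=> mE'; rewrite -[X in measurable X]setTI; exact: mLx.
  have B0 k : (0 <= \prod_j b j (k j))%R by exact: prodr_ge0.
have UE x : \int[mu]_y (\prod_j \sum_w b j w * \1_(E j w) (L j x y))%:E =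
    \sum_k U k x.
  rewrite -ge0_integral_sum//; last 2 first.
  - by move=> k; apply/measurable_EFinP; exact: (measurable_fun_pair2 _ (mu_ k)).
  - by move=> k y _; rewrite lee_fin.
  apply: eq_integral => y _; rewrite sumEFin; congr EFin.
  by rewrite bigA_distr_bigA.
rewrite (_ : [set x | _] = [set x | (\sum_k c k)%:E < \sum_k U k x]); last first.
  by apply/seteqP; split => x /=; rewrite UE.
apply: superposition_level => // k.
  have uS x (S : set T) : measurable S ->
      (forall y, (forall l, E l (k l) (L l x y)) -> S y) ->
      U k x <= (\prod_j b j (k j))%:E * mu S.
    move=> mS ES; rewrite -integral_scaled_indic//; apply: ge0_le_integral => //.
    - by move=> y _; rewrite lee_fin.
    - by apply/measurable_EFinP; exact: (measurable_fun_pair2 _ (mu_ k)).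
    - apply/measurable_EFinP; apply: measurable_funM => //; exact: measurable_indic.
    move=> y _; rewrite lee_fin uE /=; apply: ler_wpM2l => //.
    exact/prod_indic_le/ES.
  have [[j Hj]|[i [j [ij Hij]]]] := Hc k; [left => x|right].
    have := uS x (L j x @^-1` E j (k j)) (mpre _ _ _ (mE _ _)) (fun y Ey => Ey j).
    move=> /le_trans; apply.
    apply: (@le_trans _ _ ((\prod_j b j (k j))%:E * (K%:E * (e j (k j))%:E))).
      apply: lee_wpmul2l => //; first by rewrite lee_fin.
      by apply: (le_trans (L_section _ _ _)) => //; exact: lee_wpmul2l.
    by rewrite -!EFinM lee_fin.
  pose S x := L i x @^-1` E i (k i) `&` L j x @^-1` E j (k j).
  have mS x : measurable (S x) by apply: measurableI; exact: mpre.
  have mmuS : measurable_fun setT (fun x => mu (S x)).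
    pose A := (fun z : T * T => L i z.1 z.2) @^-1` E i (k i) `&`
              (fun z : T * T => L j z.1 z.2) @^-1` E j (k j).
    rewrite (_ : (fun x => _) = mu \o xsection A); last first.
      apply/funext => x /=; congr (mu _); apply/seteqP; split => y.
        by rewrite /xsection /= => Sxy; rewrite mem_set.
      by rewrite /xsection /= inE.
    apply: measurable_fun_xsection; apply: measurableI.
      by have := mL i measurableT (mE i (k i)); rewrite setTI.
    by have := mL j measurableT (mE j (k j)); rewrite setTI.
  apply: (@le_trans _ _ (\int[mu]_x ((\prod_j b j (k j))%:E * mu (S x)))).
    apply: ge0_le_integral => //; first exact: measurable_funeM.
    by move=> x _; apply: uS => // y Hy; split; exact: Hy.
  rewrite ge0_integralZl//; last by rewrite lee_fin.
  apply: (@le_trans _ _ ((\prod_j b j (k j))%:E *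
      (K%:E * (e i (k i))%:E * (e j (k j))%:E))).
    apply: lee_wpmul2l => //; first by rewrite lee_fin.
    apply: (le_trans (L_pair ij _ _)) => //.
    apply: lee_pmul => //; first by rewrite mule_ge0.
    exact: lee_wpmul2l.
  by rewrite -!EFinM lee_fin.
Qed.
End simple_core.

(** * An exponent inequality *)

Section combinatorics.
Context {R : realType}.

(** Take for kappa_i and kappa_j the smallest and the second smallest value.
    Since the weights sum to 2,
    sum theta_l kappa_l - kappa_i - kappa_j =
    (1 - theta_i) (kappa_j - kappa_i) + sum_{l <> i} theta_l (kappa_l - kappa_j),
    a sum of nonnegative terms controlling every difference kappa_l - kappa_i.
    The marked index o, where kappa vanishes, turns differences into absolute
    values. *)
Lemma spread_pair (I : finType) (o : I) (theta kappa : I -> R) (eps : R) :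
  kappa o = 0 -> \sum_i theta i = 2 -> 0 < eps ->
  (forall i, eps <= theta i <= 1 - eps) ->
  exists i j, i != j /\
    forall l, eps * `|kappa l| <= \sum_l theta l * kappa l - kappa i - kappa j.
Proof.
move=> ko th2 e0 he.
pose i := [arg min_(i < o) kappa i]%O.
have ki l : kappa i <= kappa l by rewrite /i; case: arg_minP => // m _ /(_ l isT).
have [j0 j0i] : exists j0, j0 != i.
  apply: contrapT => noj; move: th2; rewrite (bigD1 i)//= big1 => [|j ji].
    by have := he i; lra.
  by exfalso; apply: noj; exists j.
pose j := [arg min_(j < j0 | j != i) kappa j]%O.
have ji : j != i by rewrite /j; case: arg_minP.
have kj l : l != i -> kappa j <= kappa l.
  by rewrite /j; case: arg_minP => // m _ + li => /(_ l li).
have gap : \sum_l theta l * kappa l - kappa i - kappa j =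
    (1 - theta i) * (kappa j - kappa i) + \sum_(l | l != i) theta l * (kappa l - kappa j).
  have -> : \sum_(l | l != i) theta l * (kappa l - kappa j) =
      \sum_(l | l != i) theta l * kappa l - (\sum_(l | l != i) theta l) * kappa j.
    by rewrite mulr_suml -sumrB; apply: eq_bigr => l _; rewrite mulrBr.
  move: th2; rewrite (bigD1 i)//= => th2.
  by rewrite [in LHS](bigD1 i)//= (_ : \sum_(l | l != i) theta l = 2 - theta i); [ring|lra].
have tpos l : 0 <= theta l by have := he l; lra.
have main l : eps * (kappa l - kappa i) <=
    \sum_l theta l * kappa l - kappa i - kappa j.
  have := ki j; have := he i.
  rewrite gap; have [->|li] := eqVneq l i => hi hij.
    rewrite subrr mulr0 addr_ge0//; first by apply: mulr_ge0; lra.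
    by apply: sumr_ge0 => m mi; rewrite mulr_ge0// subr_ge0 kj.
  rewrite (bigD1 l)//= addrA.
  have : 0 <= \sum_(m | (m != i) && (m != l)) theta m * (kappa m - kappa j).
    by apply: sumr_ge0 => m /andP[mi _]; rewrite mulr_ge0// subr_ge0 kj.
  have := kj _ li; have := he l => hl hjl.
  have : eps * (kappa j - kappa i) <= (1 - theta i) * (kappa j - kappa i).
    by apply: ler_wpM2r; lra.
  have : eps * (kappa l - kappa j) <= theta l * (kappa l - kappa j).
    by apply: ler_wpM2r; lra.
  lra.
exists i, j; split; first by rewrite eq_sym.
move=> l; have := ki o; rewrite ko => ki0.
apply: (@le_trans _ _ (eps * (Num.max (kappa l) 0 - kappa i))).
  apply: ler_wpM2l; first exact: ltW.
  have := ki l => kl; rewrite ler_norml; have [] := leP (kappa l) 0 => h; lra.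
by have [_|_] := leP (kappa l) 0; rewrite ?main// -[X in X - kappa i]ko main.
Qed.

(** Reads an index below 2 N as an integer between -N and N - 1. *)
Definition signed_index (N i : nat) : R := i%:R - N%:R.

Lemma sum_signed_index_le (x : R) N : 0 < x -> x < 1 ->
  \sum_(i < N + N) x `^ `|signed_index N i| <= 2 * (1 - x)^-1.
Proof.
move=> x0 x1; rewrite big_split_ord /= mulr2n mulrDl mul1r; apply: lerD.
  rewrite (reindex_inj rev_ord_inj) /=; apply: le_trans (sum_geometric_le N (ltW x0) x1).
  apply: ler_sum => i _; rewrite -powR_mulrn; last exact: ltW.
  rewrite /signed_index natrB// addrAC subrr add0r normrN ger0_norm// ger_powR//.
    by rewrite x0 ltW.
  by rewrite ler_nat.
apply: le_trans (sum_geometric_le N (ltW x0) x1).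
apply: ler_sum => i _; rewrite -powR_mulrn; last exact: ltW.
by rewrite /signed_index natrD addrAC subrr add0r ger0_norm.
Qed.

End combinatorics.

(** * Level estimate for the multilinear form *)

Section core.
Local Open Scope ereal_scope.
Context d (T : measurableType d) (R : realType).
Variable mu : {sigma_finite_measure set T -> \bar R}.
Variables (J : finType) (L : J -> T -> T -> T) (K : R).
Hypothesis mL : forall j, measurable_fun setT (fun z : T * T => L j z.1 z.2).
Hypothesis K0 : (0 <= K)%R.
Hypothesis L_section : forall j x E, measurable E ->
  mu (L j x @^-1` E) <= K%:E * mu E.
Hypothesis L_pair : forall i j E F, i != j -> measurable E -> measurable F ->
  \int[mu]_x mu (L i x @^-1` E `&` L j x @^-1` F) <= K%:E * mu E * mu F.

Definition multilinear (f : J -> T -> R) (x : T) : \bar R :=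
  \int[mu]_y (\prod_j f j (L j x y))%:E.

Lemma measurable_multilinear_integrand (f : J -> T -> R) :
  (forall j, measurable_fun setT (f j)) ->
  measurable_fun setT (fun z : T * T => (\prod_j f j (L j z.1 z.2))%:E).
Proof.
move=> mf; apply/measurable_EFinP; apply: measurable_prod => j _.
exact: (measurableT_comp (mf j) (mL j)).
Qed.

Lemma measurable_multilinear (f : J -> T -> R) :
  (forall j, measurable_fun setT (f j)) -> (forall j z, (0 <= f j z)%R) ->
  measurable_fun setT (multilinear f).
Proof.
move=> mf f0; apply: (@measurable_fun_fubini_tonelli_F _ _ _ _ _ mu
   (fun z => (\prod_j f j (L j z.1 z.2))%:E)).
  exact: measurable_multilinear_integrand.
by move=> z; rewrite lee_fin prodr_ge0.
Qed.

Variables (theta : J -> R) (theta0 eps delta : R).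
Hypothesis theta_sum : (\sum_j theta j + theta0 = 2)%R.
Hypothesis eps0 : (0 < eps)%R.
Hypothesis theta_eps : forall j, (eps <= theta j <= 1 - eps)%R.
Hypothesis theta0_eps : (eps <= theta0 <= 1 - eps)%R.
Hypothesis delta0 : (0 < delta)%R.
Hypothesis delta_eps : (2 * delta * #|J|%:R <= eps)%R.

Lemma ratio_lt1 : (2 `^ (- delta) < 1 :> R)%R.
Proof.
rewrite powRN invf_lt1 ?powR_gt0// /powR gt_eqF// expR_gt1 mulr_gt0//.
by rewrite ln_gt0// ltr1n.
Qed.

(** This is B_j 2^(delta |k|) (2^k t)^(-theta_j), with the power expanded. *)
Definition envelope (B : J -> R) (t : R) (j : J) (k : R) : R :=
  (B j * 2 `^ (delta * `|k| - theta j * k) * t `^ (- theta j))%R.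

Definition multilinear_cst : R :=
  (4 * K * (2 * (1 - 2 `^ (- delta))^-1) ^+ #|J|)%R.

(** [spread_pair] for the indices of the factors together with one more index,
    of weight [theta0] and value 0, for the output.  When the pair contains the
    extra index only one factor is used (first alternative), otherwise two. *)
Lemma exponent_pair (k : J -> R) :
  (exists j, (\sum_l (delta * `|k l| - theta l * k l) + k j
     <= - \sum_l delta * `|k l|)%R) \/
  (exists i j, i != j /\ (\sum_l (delta * `|k l| - theta l * k l) + k i + k j
     <= - \sum_l delta * `|k l|)%R).
Proof.
pose th o := if o is Some j then theta j else theta0.
pose kap o := if o is Some j then k j else 0%R.
have [||||i [j [ij Hij]]] := @spread_pair R _ None th kap eps => //.
- by rewrite big_option /= addrC.
- by case.
move: Hij; rewrite big_option /= mulr0 add0r => Hij.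
set S := (\sum_l theta l * k l)%R in Hij.
set G := (S - kap i - kap j)%R in Hij.
have dG : (2 * (\sum_l delta * `|k l|) <= G)%R.
  have J0 : (0 < #|J|)%N.
    by case: i ij {G Hij} => [i|]; [move=> _; apply/card_gt0P; exists i
      | case: j => // j _; apply/card_gt0P; exists j].
  have J0' : (0 < #|J|%:R :> R)%R by rewrite ltr0n.
  rewrite -(ler_pM2l J0') -mulr_sumr.
  apply: (@le_trans _ _ (eps * \sum_l `|k l|)%R).
    rewrite !mulrA; apply: ler_wpM2r; last (move: delta_eps; lra).
    by apply: sumr_ge0.
  rewrite mulr_sumr; apply: (@le_trans _ _ (\sum_(l : J) G)%R).
    by apply: ler_sum => l _; exact: (Hij (Some l)).
  by rewrite sumr_const -[leLHS]mulr_natl.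
have sE : (\sum_l (delta * `|k l| - theta l * k l) = \sum_l delta * `|k l| - S)%R.
  by rewrite sumrB.
rewrite sE; move: dG; rewrite /G; case: i j ij {Hij G} => [i|] [j|] //= ij dG.
- by right; exists i, j; split => //; lra.
- by left; exists i; lra.
- by left; exists j; lra.
Qed.

(** The layers E_{j,k} are the sets where f_j exceeds the next envelope value, so
    that they have measure at most 2^(k+1) t.  By [exponent_pair] the constants of
    the restricted terms may be taken to be a product over the factors of
    2^(-delta |k_j|), which sums to a bound that does not depend on N. *)
Lemma multilinear_truncated_level (f : J -> T -> R) (B : J -> R) (t : R) (N : nat) :
  (forall j, measurable_fun setT (f j)) ->
  (forall j, (0 <= B j)%R) -> (0 < t)%R ->
  (forall j (k : int), mu [set x | (envelope B t j k%:~R < f j x)%R] <=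
     (2 `^ k%:~R * t)%:E) ->
  mu [set x | (multilinear_cst * (\prod_j B j) * t `^ (theta0 - 1))%:E <
     multilinear (fun j z => \sum_(i < N + N) envelope B t j (signed_index N i) *
        \1_[set x | (envelope B t j (signed_index N i.+1) < f j x)%R] z)%R x] <= t%:E.
Proof.
move=> mf B0 t0 Hf.
pose E j (i : 'I_(N + N)) := [set x | (envelope B t j (signed_index N i.+1) < f j x)%R].
pose b j (i : 'I_(N + N)) := envelope B t j (signed_index N i).
pose e (j : J) (i : 'I_(N + N)) := (2 `^ (signed_index N i + 1) * t)%R.
have levE i : signed_index N i = ((i : int) - (N : int))%:~R.
  by rewrite /signed_index rmorphB.
have levS i : (signed_index N i.+1 = signed_index N i + 1)%R by rewrite /signed_index -natr1; lra.
have b0 j i : (0 <= b j i)%R by rewrite /b /envelope !mulr_ge0 ?powR_ge0.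
have e0 j i : (0 <= e j i)%R by rewrite /e mulr_ge0 ?powR_ge0// ltW.
have mE j i : measurable (E j i).
  exact: measurable_superlevel.
have muE j i : mu (E j i) <= (e j i)%:E by rewrite /E /e -levS levE; exact: Hf.
(* one factor contributes an extra 2 and two factors an extra 4, since the layers
   have measure 2^(k+1) t; hence the constant 4 *)
pose c (k : {ffun J -> 'I_(N + N)}) := (4 * K * (\prod_j B j) * t `^ (theta0 - 1) *
   \prod_j (2 `^ (- delta)) `^ `|signed_index N (k j)|)%R.
have PB0 : (0 <= \prod_j B j)%R by exact: prodr_ge0.
have c0 k : (0 <= c k)%R.
  by rewrite /c !mulr_ge0 ?powR_ge0//; apply: prodr_ge0 => j _; exact: powR_ge0.
have csum : (\sum_k c k <= multilinear_cst * (\prod_j B j) * t `^ (theta0 - 1))%R.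
  rewrite /c -mulr_sumr -(bigA_distr_bigA (fun j (i : 'I_(N + N)) =>
    (2 `^ (- delta)) `^ `|signed_index N i|)%R) /=.
  set P := (\prod_(j : J) \sum_(i < N + N) _)%R.
  have PA : (P <= (2 * (1 - 2 `^ (- delta))^-1) ^+ #|J|)%R.
    rewrite -prodr_const; apply: ler_prod => j _; apply/andP; split.
      by apply: sumr_ge0 => i _; exact: powR_ge0.
    by apply: sum_signed_index_le; [exact: powR_gt0|exact: ratio_lt1].
  rewrite /multilinear_cst [leRHS](_ : _ = 4 * K * (\prod_j B j) * t `^ (theta0 - 1) *
    (2 * (1 - 2 `^ (- delta))^-1) ^+ #|J|)%R; last by ring.
  by apply: ler_wpM2l => //; rewrite !mulr_ge0 ?powR_ge0.
have cE (k : {ffun J -> 'I_(N + N)}) : (c k = 4 * K * (\prod_j B j) * t `^ (theta0 - 1) *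
    2 `^ (- \sum_j delta * `|signed_index N (k j)|))%R.
  rewrite /c; congr (_ * _)%R; rewrite -sumrN -prod_powR//.
  by apply: eq_bigr => j _; rewrite -powRrM mulNr.
have bprod (k : {ffun J -> 'I_(N + N)}) : (\prod_j b j (k j) = (\prod_j B j) *
    2 `^ (\sum_j (delta * `|signed_index N (k j)| - theta j * signed_index N (k j))) *
    t `^ (theta0 - 2))%R.
  rewrite /b /envelope [LHS]big_split [X in (X * _ = _)%R]big_split /= !prod_powR//.
  congr (_ * t `^ _)%R.
  by rewrite sumrN; move: theta_sum; lra.
have Hc (k : {ffun J -> 'I_(N + N)}) :
    (exists j, (\prod_j b j (k j)) * (K * e j (k j)) <= c k)%R \/
    (exists i j, i != j /\
       (\prod_j b j (k j)) * (K * e i (k i) * e j (k j)) <= t * c k)%R.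
  have tM1 : (t `^ (theta0 - 2) * t = t `^ (theta0 - 1))%R.
    rewrite -{2}(powRr1 (ltW t0)) -powRD ?(gt_eqF t0) ?implybT//.
    by congr (_ `^ _)%R; lra.
  have two_add (u v : R) : (2 `^ (u + v) = 2 `^ u * 2 `^ v :> R)%R.
    by rewrite powRD// pnatr_eq0 implybT.
  have two1 : (2 `^ 1 = 2 :> R)%R by rewrite powRr1.
  have KB0 : (0 <= K * (\prod_j B j) * t `^ (theta0 - 1))%R.
    by rewrite !mulr_ge0 ?powR_ge0.
  rewrite bprod cE; set S1 := (\sum_j (_ - _))%R; set S2 := (\sum_j _)%R.
  have [[j Hj]|[i [j [ij Hij]]]] := exponent_pair (fun j => signed_index N (k j)).
    left; exists j; rewrite /e; move: (signed_index N (k j)) Hj => kj Hj; rewrite two_add two1.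
    rewrite [leLHS](_ : _ = K * (\prod_j B j) * t `^ (theta0 - 1) *
      (2 * 2 `^ (S1 + kj)))%R; last by rewrite two_add -tM1; ring.
    rewrite [leRHS](_ : _ = K * (\prod_j B j) * t `^ (theta0 - 1) *
      (4 * 2 `^ (- S2)))%R; last by ring.
    apply: ler_wpM2l => //; apply: ler_pM; rewrite ?powR_ge0 ?ler_nat//.
    by apply: ler_powR => //; rewrite ler1n.
  right; exists i, j; split => //; rewrite /e.
  move: (signed_index N (k i)) (signed_index N (k j)) Hij => ki kj Hij; rewrite !two_add two1.
  rewrite [leLHS](_ : _ = K * (\prod_j B j) * t `^ (theta0 - 1) *
    (t * 4 * 2 `^ (S1 + ki + kj)))%R; last first.
    by rewrite !two_add -tM1; ring.
  rewrite [leRHS](_ : _ = K * (\prod_j B j) * t `^ (theta0 - 1) *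
    (t * 4 * 2 `^ (- S2)))%R; last by ring.
  apply: ler_wpM2l => //; apply: ler_wpM2l; first by rewrite mulr_ge0// ltW.
  by apply: ler_powR => //; rewrite ler1n.
apply: le_trans (multilinear_simple_level mL K0 L_section L_pair t0 mE b0 e0 muE c0 Hc).
pose F j z := (\sum_(i < N + N) b j i * \1_(E j i) z)%R.
have mF j : measurable_fun setT (F j).
  apply: measurable_sum => i; apply: measurable_funM; first exact: measurable_cst.
  by apply: measurable_indic; exact: mE.
have F0 j z : (0 <= F j z)%R by apply: sumr_ge0 => i _; rewrite mulr_ge0.
have mlt (x : \bar R) : measurable [set y | x < multilinear F y].
  rewrite -[X in measurable X]setTI; apply: emeasurable_fun_o_infty => //.
  exact: measurable_multilinear.
apply: le_measure; rewrite ?inE; [exact: mlt|exact: mlt|].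
by move=> x /=; apply: le_lt_trans; rewrite lee_fin.
Qed.

Lemma multilinear_eq0 (f : J -> T -> R) (j : J) x :
  (forall j, measurable_fun setT (f j)) -> (forall j z, (0 <= f j z)%R) ->
  mu [set z | (0 < f j z)%R] = 0 -> multilinear f x = 0.
Proof.
move=> mf f0 fj0.
have mS : measurable [set z | (0 < f j z)%R].
  exact: measurable_superlevel.
have mint : measurable_fun setT (fun y => (\prod_j f j (L j x y))%:E).
  exact: (measurable_fun_pair2 _ (measurable_multilinear_integrand mf)).
have Lx0 : mu (L j x @^-1` [set z | (0 < f j z)%R]) = 0.
  apply/eqP; rewrite -measure_le0; apply: (le_trans (L_section _ _ mS)).
  by rewrite fj0 mule0.
have p0 y : 0 <= (\prod_j f j (L j x y))%:E by rewrite lee_fin prodr_ge0.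
have : \int[mu]_y `|(\prod_j f j (L j x y))%:E| = 0.
  apply/(ae_eq_integral_abs mu measurableT mint).
  exists (L j x @^-1` [set z | (0 < f j z)%R]); split => //.
    rewrite -[X in measurable X]setTI.
    by apply: (measurable_fun_pair2 _ (mL j)).
  move=> y /= /not_implyP[_]; apply: contra_notP => /negP.
  rewrite -leNgt => fle; rewrite (bigD1 j)//= (_ : f j _ = 0%R) ?mul0r//.
  by apply/eqP; rewrite eq_le fle f0.
by under eq_integral do rewrite gee0_abs//.
Qed.

(** If some B_j is zero, the j-th factor vanishes almost everywhere and so does
    the form.  Otherwise the envelopes run from infinity to zero, and truncating
    each f_j to the values between the envelopes at N and -N gives functions that
    increase to f_j and are dominated by finitely many layers. *)
Lemma multilinear_level (f : J -> T -> R) (B : J -> R) (t : R) :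
  (forall j, measurable_fun setT (f j)) -> (forall j z, (0 <= f j z)%R) ->
  (forall j, (0 <= B j)%R) -> (0 < t)%R ->
  (forall j (k : int), mu [set x | (envelope B t j k%:~R < f j x)%R] <=
     (2 `^ k%:~R * t)%:E) ->
  mu [set x | (multilinear_cst * (\prod_j B j) * t `^ (theta0 - 1))%:E <
     multilinear f x] <= t%:E.
Proof.
move=> mf f0 B0 t0 Hf.
have [/existsP[j /eqP Bj]|/existsPn Bn0] := boolP [exists j, B j == 0%R].
  rewrite [X in mu X](_ : _ = set0) ?measure0 ?lee_fin ?ltW//.
  apply/seteqP; split => // x /=; rewrite (bigD1 j)//= Bj mul0r mulr0 mul0r.
  rewrite (@multilinear_eq0 _ j) ?ltxx//.
  apply/eqP; rewrite -measure_le0; apply/lee_addgt0Pr => e e0; rewrite add0e.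
  have [|||N HN] := @expr_eventually_lt R 2^-1 (e / t).
  - by rewrite invr_ge0.
  - by rewrite invf_lt1// ltr1n.
  - exact: divr_gt0.
  have := Hf j (- (N : int))%R; rewrite [X in mu X](_ : _ = [set z | (0 < f j z)%R]); last first.
    by apply/seteqP; split => z /=; rewrite /envelope Bj !mul0r.
  move=> /le_trans; apply; rewrite lee_fin -ler_pdivlMr// ltW//.
  by rewrite (le_lt_trans _ HN)// rmorphN powRN powR_mulrn// exprVn.
have Bpos j : (0 < B j)%R by rewrite lt_neqAle eq_sym Bn0 B0.
have deltaE j : (delta < theta j)%R.
  have J1 : (1 <= #|J|%:R :> R)%R by rewrite ler1n; apply/card_gt0P; exists j.
  have : (2 * delta * 1 <= 2 * delta * #|J|%:R)%R.
    by apply: ler_wpM2l => //; rewrite mulr_ge0// ltW.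
  by have := theta_eps j; move: delta_eps delta0; lra.
have two_lt1 (u : R) : (u < 0)%R -> (2 `^ u < 1 :> R)%R.
  by move=> u0; rewrite /powR gt_eqF// expR_lt1 nmulr_rlt0// ln_gt0// ltr1n.
pose tp j := (t `^ (- theta j))%R.
have tp0 j : (0 < tp j)%R by exact: powR_gt0.
(* along nonnegative k the envelope is geometric of ratio lo < 1, along
   nonpositive k of ratio 1 / up > 1 *)
pose lo j := (2 `^ (delta - theta j))%R : R.
pose up j := (2 `^ (- (delta + theta j)))%R : R.
have env_pos j N : envelope B t j N%:R = (B j * tp j * lo j ^+ N)%R.
  rewrite /envelope /tp /lo ger0_norm// -mulrBl powRrM powR_mulrn ?powR_ge0//.
  by rewrite mulrAC.
have env_neg j N : envelope B t j (- N%:R) = (B j * tp j / up j ^+ N)%R.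
  rewrite /envelope /tp /up normrN ger0_norm// mulrN opprK -mulrDl.
  by rewrite -powR_mulrn ?powR_ge0// -powRrM mulNr (powRN 2) invrK mulrAC.
have lo01 j : (0 <= lo j < 1)%R by rewrite powR_ge0/= two_lt1// subr_lt0.
have up01 j : (0 < up j < 1)%R.
  by rewrite powR_gt0//= two_lt1// oppr_lt0 addr_gt0// (lt_trans delta0).
have lo_nd j N M : (N <= M)%N -> (envelope B t j M%:R <= envelope B t j N%:R)%R.
  move=> NM; rewrite !env_pos; apply: ler_wpM2l; first by rewrite mulr_ge0// ltW.
  by have /andP[? /ltW ?] := lo01 j; exact: ler_wiXn2l.
have up_nd j N M : (N <= M)%N -> (envelope B t j (- N%:R) <= envelope B t j (- M%:R))%R.
  move=> NM; rewrite !env_neg; apply: ler_wpM2l; first by rewrite mulr_ge0// ltW.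
  have /andP[u0 /ltW u1] := up01 j; rewrite lef_pV2 ?posrE ?exprn_gt0//.
  by apply: ler_wiXn2l => //; exact: ltW.
pose h N j z := if (envelope B t j N%:R < f j z <= envelope B t j (- N%:R))%R
  then f j z else 0%R.
have h0 N j z : (0 <= h N j z)%R by rewrite /h; case: ifP.
have mh N j : measurable_fun setT (h N j).
  rewrite (_ : h N j = (fun z => f j z * \1_(f j @^-1`
      `]envelope B t j N%:R, envelope B t j (- N%:R)]) z)%R).
    apply: measurable_funM => //; apply: measurable_indic.
    by rewrite -[X in measurable X]setTI; exact: mf.
  apply/funext => z; rewrite /h indicE; case: ifPn => [fz|nfz].
    by rewrite mem_set ?mulr1//= in_itv.
  by rewrite memNset ?mulr0//= in_itv; exact/negP.
have hf j z : exists N0, forall N, (N0 <= N)%N -> h N j z = f j z.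
  have [fz|fz] := ltP 0%R (f j z); last first.
    have fz0 : f j z = 0%R by apply/eqP; rewrite eq_le fz f0.
    by exists 0%N => N _; rewrite /h fz0 if_same.
  have /andP[lo0 lo1] := lo01 j; have /andP[up0 up1] := up01 j.
  have Bt : (0 < B j * tp j)%R by exact: mulr_gt0.
  have [|N1 HN1] := expr_eventually_lt lo0 lo1 (_ : 0 < f j z / (B j * tp j))%R.
    exact: divr_gt0.
  have [|N2 HN2] := expr_eventually_lt (ltW up0) up1 (_ : 0 < B j * tp j / f j z)%R.
    exact: divr_gt0.
  exists (maxn N1 N2) => N; rewrite geq_max => /andP[N1N N2N].
  rewrite /h (le_lt_trans (lo_nd _ _ _ N1N)) ?(le_trans _ (up_nd _ _ _ N2N))//.
    rewrite env_neg ler_pdivlMr ?exprn_gt0// mulrC -ler_pdivlMr// ltW//.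
  by rewrite env_pos mulrC -ltr_pdivlMr.
have h_nd j z N M : (N <= M)%N -> (h N j z <= h M j z)%R.
  move=> NM; rewrite {1}/h; case: ifPn => // /andP[lof fup].
  by rewrite /h (le_lt_trans (lo_nd _ _ _ NM) lof) (le_trans fup (up_nd _ _ _ NM)).
have h_le N j z : (h N j z <= \sum_(i < N + N) envelope B t j (signed_index N i) *
        \1_[set x | (envelope B t j (signed_index N i.+1) < f j x)%R] z)%R.
  have t_ge0 (i : 'I_(N + N)) : (0 <= envelope B t j (signed_index N i) *
      \1_[set x | (envelope B t j (signed_index N i.+1) < f j x)%R] z)%R.
    by rewrite /envelope !mulr_ge0 ?powR_ge0.
  rewrite /h; case: ifPn => [/andP[lof fup]|_]; last exact: sumr_ge0.
  have [||i [iN loi upi]] := @crossing R (fun i => envelope B t j (signed_index N i))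
      (N + N) (f j z).
  - by rewrite /signed_index natrD addrK.
  - by rewrite /signed_index sub0r.
  rewrite (bigD1 (Ordinal iN))//= -[leLHS]addr0; apply: lerD; last exact: sumr_ge0.
  by rewrite indicE mem_set//= mulr1.
pose C0 := (multilinear_cst * (\prod_j B j) * t `^ (theta0 - 1))%:E.
have mN (g : J -> T -> R) : (forall j, measurable_fun setT (g j)) -> (forall j z, (0 <= g j z)%R) ->
    measurable [set x | C0 < multilinear g x].
  move=> mg g0; rewrite -[X in measurable X]setTI; apply: emeasurable_fun_o_infty => //.
  exact: measurable_multilinear.
have mint (g : J -> T -> R) x : (forall j, measurable_fun setT (g j)) ->
    measurable_fun setT (fun y => (\prod_j g j (L j x y))%:E).
  by move=> mg; exact: (measurable_fun_pair2 _ (measurable_multilinear_integrand mg)).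
have hcvg x : multilinear (h N) x @[N --> \oo] --> multilinear f x.
  have p0 N y : 0 <= (\prod_j h N j (L j x y))%:E by rewrite lee_fin prodr_ge0.
  have nd y : nondecreasing_seq (fun N => (\prod_j h N j (L j x y))%:E).
    move=> N M NM; rewrite lee_fin; apply: ler_prod => j _; rewrite h0; exact: h_nd.
  have := @cvg_monotone_convergence _ _ _ mu setT measurableT
    (fun N y => (\prod_j h N j (L j x y))%:E) (fun N => mint _ _ (mh N))
    (fun N y _ => p0 N y) (fun y _ => nd y).
  rewrite (_ : (fun y => _) = fun y => (\prod_j f j (L j x y))%:E)//.
  apply/funext => y; apply: cvg_lim => //; apply: cvg_near_cst.
  have [N0 HN0] := choice (fun j => hf j (L j x y)).
  exists (\max_j N0 j) => // N /= HN; congr EFin; apply: eq_bigr => j _.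
  by apply: HN0; apply: leq_trans HN; exact: leq_bigmax.
have nd_mult x N M : (N <= M)%N -> multilinear (h N) x <= multilinear (h M) x.
  move=> NM; apply: ge0_le_integral => //; try by apply: mint.
  - by move=> y _; rewrite lee_fin prodr_ge0.
  - by move=> y _; rewrite lee_fin; apply: ler_prod => j _; rewrite h0 h_nd.
apply: (@le_trans _ _ (mu (\bigcup_N [set x | C0 < multilinear (h N) x]))).
  apply: le_measure; rewrite ?inE.
  - exact: mN.
  - by apply: bigcupT_measurable => N; exact: mN.
  move=> x /=; apply: contraPP => nx; apply/negP; rewrite -leNgt.
  rewrite -(cvg_lim _ (hcvg x))//; apply: lime_le; first by apply/cvg_ex; eexists; exact: hcvg.
  apply: nearW => N; rewrite leNgt; apply/negP => CN; apply: nx; by exists N.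
apply: measure_bigcup_le => [N||N]; first exact: mN.
  move=> N M NM; apply/subsetPset => x /= /lt_le_trans; apply; exact: nd_mult.
apply: le_trans (multilinear_truncated_level N mf B0 t0 Hf).
have mS j : measurable_fun setT (fun z => \sum_(i < N + N) envelope B t j (signed_index N i) *
    \1_[set x | (envelope B t j (signed_index N i.+1) < f j x)%R] z)%R.
  apply: measurable_sum => i; apply: measurable_funM; first exact: measurable_cst.
  by apply: measurable_indic; exact: measurable_superlevel.
apply: le_measure; rewrite ?inE.
- exact: mN.
- apply: mN => // j z; exact: le_trans (h_le N j z).
move=> x /= /lt_le_trans; apply; apply: ge0_le_integral => //.
- by move=> y _; rewrite lee_fin prodr_ge0.
- exact: (mint _ _ (mh N)).
- exact: (mint _ _ mS).
- by move=> y _; rewrite lee_fin; apply: ler_prod => j _; rewrite h0 h_le.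
Qed.

End core.

(** * Rearrangements and dilations *)

Section rearrangement.
Local Open Scope ereal_scope.
Context d (T : measurableType d) (R : realType).
Variable mu : {measure set T -> \bar R}.
Implicit Type f : T -> R[i].

Lemma rearrangement_ge0 f t : 0 <= rearrangement mu f t.
Proof. by apply: le_ereal_inf_tmp => _ [l [l0 _] <-]; rewrite lee_fin. Qed.

Lemma rearrangement_le f t (b : R) : (0 <= b)%R ->
  mu [set x | (b < Normc.normc (f x))%R] <= t%:E -> rearrangement mu f t <= b%:E.
Proof. by move=> b0 H; apply: ereal_inf_lbound; exists b. Qed.

Lemma rearrangement_nonincreasing f s t : (s <= t)%R ->
  rearrangement mu f t <= rearrangement mu f s.
Proof.
move=> st; apply: le_ereal_inf => _ [l [l0 ls] <-]; exists l => //; split => //.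
by apply: (le_trans ls); rewrite lee_fin.
Qed.

Lemma measurable_normc f : cmeasurable f ->
  measurable_fun setT (fun x => Normc.normc (f x)).
Proof.
move=> [mRe mIm].
rewrite (_ : (fun x => _) = (fun x => (complex.Re (f x) ^+ 2 + complex.Im (f x) ^+ 2) `^ 2^-1)%R).
  apply: (measurableT_comp (measurable_powR _)).
  by apply: measurable_funD; exact: measurable_funX.
apply/funext => x; case: (f x) => a b /=.
by rewrite powR12_sqrt// addr_ge0 ?sqr_ge0.
Qed.

(** The infimum defining the rearrangement is attained, by continuity of the
    measure along the superlevel sets at heights decreasing to b. *)
Lemma distribution_rearrangement_le f t (b : R) : cmeasurable f ->
  rearrangement mu f t <= b%:E -> mu [set x | (b < Normc.normc (f x))%R] <= t%:E.
Proof.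
move=> mf fb; have mn := measurable_normc mf.
have mlt (c : R) : measurable [set x | (c < Normc.normc (f x))%R].
  exact: measurable_superlevel.
rewrite (_ : [set x | _] = \bigcup_n [set x | (b + n.+1%:R^-1 < Normc.normc (f x))%R]).
  apply: measure_bigcup_le => // [n m nm|n].
    apply/subsetPset => x /=; apply: le_lt_trans.
    by rewrite lerD2l lef_pV2 ?posrE// ler_nat ltnS.
  have : rearrangement mu f t < (b + n.+1%:R^-1)%:E.
    by apply: (le_lt_trans fb); rewrite lte_fin ltrDl.
  move=> /ereal_inf_lt[_ [l [l0 lt_] <-]]; rewrite lte_fin => lb.
  apply: le_trans lt_; apply: le_measure; rewrite ?inE// => x /=.
  exact: lt_trans.
apply/seteqP; split => x /=; last first.
  by move=> [n _ /=]; apply: le_lt_trans; rewrite lerDl invr_ge0.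
move=> bf; have e0 : (0 < Normc.normc (f x) - b)%R by rewrite subr_gt0.
near \oo => n; exists n => //=; rewrite -ltrBrDl.
by near: n; exact: (near_infty_natSinv_lt (PosNum e0)).
Unshelve. all: by end_near. Qed.

Lemma nonincreasing_emeasurable (g : R -> \bar R) :
  (forall s t, (s <= t)%R -> g t <= g s) -> measurable_fun setT g.
Proof.
move=> g_ni; apply: (measurability _ (ErealGenOInfty.measurableE R)) => //.
move=> _ [_ [a ->] <-]; rewrite setTI; apply: is_interval_measurable => s t /=.
rewrite !in_itv /= !andbT => gs gt u /andP[su ut].
by rewrite in_itv /= andbT (lt_le_trans gt)// g_ni.
Qed.

End rearrangement.

Section dilation.
Local Open Scope ereal_scope.
Context {R : realType}.
Notation lambda := (@lebesgue_measure R).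

(** The measure dt/t on the half-line is invariant under dilations. *)
Lemma ge0_integral_dilation (g : R -> \bar R) (c : R) :
  measurable_fun setT g -> (forall t, 0 <= g t) -> (0 < c)%R ->
  \int[lambda]_(t in `]0%R, +oo[) (g (c * t)%R * (t^-1)%:E) =
  \int[lambda]_(t in `]0%R, +oo[) (g t * (t^-1)%:E).
Proof.
move=> mg g0 c0.
pose phi : measurableTypeR R -> measurableTypeR R := fun t => (0 + c * t)%R.
have mphi : measurable_fun setT phi by exact: measurable_affine_line.
pose G (s : measurableTypeR R) := g s * (s `^ (-1))%:E.
have GE s : `]0%R, +oo[%classic s -> G s = g s * (s^-1)%:E.
  by rewrite /G /= in_itv /= andbT => s0; rewrite powR_inv1// ltW.
have mG : measurable_fun setT G.
  by apply: emeasurable_funM => //; apply/measurable_EFinP; exact: measurable_powR.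
have G0 s : 0 <= G s by rewrite mule_ge0// lee_fin powR_ge0.
have mpos : measurable (`]0%R, +oo[%classic : set (measurableTypeR R)) by exact: measurable_itv.
have phiE : phi @^-1` `]0%R, +oo[%classic = `]0%R, +oo[%classic.
  by apply/seteqP; split => t /=; rewrite /phi !in_itv /= !andbT add0r pmulr_rgt0.
have := @ge0_integral_pushforward _ _ _ _ R phi mphi lambda `]0%R, +oo[%classic G mpos
  (measurable_funS measurableT (@subsetT _ _) mG) (fun y _ => G0 y).
rewrite phiE => H.
transitivity (c%:E * \int[pushforward lambda phi]_(y in `]0%R, +oo[) G y).
  rewrite H -ge0_integralZl//; last 3 first.
  - by apply: measurable_funTS; exact: (measurableT_comp mG mphi).
  - by move=> t _; exact: G0.
  - by rewrite lee_fin ltW.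
  apply: eq_integral => t /[!inE] t0; rewrite /= GE /phi add0r; last first.
    by move: t0; rewrite /= !in_itv /= !andbT; exact: mulr_gt0.
  rewrite muleCA -EFinM invfM mulrA mulfV ?mul1r// gt_eqF//.
have ci0 : (0 <= c^-1)%R by rewrite invr_ge0 ltW.
transitivity (c%:E * \int[mscale (NngNum ci0) lambda]_(y in `]0%R, +oo[) G y).
  congr (_ * _); apply: eq_measure_integral => S mS _ /=.
  rewrite /pushforward /mscale /= lebesgue_measure_affine ?gt_eqF// gtr0_norm//.
rewrite ge0_integral_mscale//; last exact: measurable_funTS.
rewrite muleA -EFinM mulfV ?gt_eqF// mul1e.
by apply: eq_integral => t /[!inE] t0; rewrite GE.
Qed.

End dilation.

(** * Dyadic majorants in Lorentz spaces *)

Section majorant.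
Local Open Scope ereal_scope.
Context d (T : measurableType d) (R : realType).
Variable mu : {measure set T -> \bar R}.
Notation lambda := (@lebesgue_measure R).
Variables (f : T -> R[i]) (p q : R).
Hypotheses (p0 : (0 < p)%R) (q0 : (0 < q)%R).

Definition lorentz_density (t : R) : \bar R :=
  ((t `^ p^-1)%:E * rearrangement mu f t) `^ q.

Definition lorentz_power : \bar R :=
  \int[lambda]_(t in `]0%R, +oo[) (lorentz_density t * (t^-1)%:E).

Lemma lorentz_normE : lorentz_norm mu p q%:E f = lorentz_power `^ q^-1.
Proof. by []. Qed.

Lemma lorentz_density_ge0 t : 0 <= lorentz_density t.
Proof. exact: poweR_ge0. Qed.

Lemma measurable_lorentz_density : measurable_fun setT lorentz_density.
Proof.
apply: (measurableT_comp (measurable_poweR q)); apply: emeasurable_funM.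
  by apply/measurable_EFinP; exact: measurable_powR.
by apply: nonincreasing_emeasurable => s t; exact: rearrangement_nonincreasing.
Qed.

Lemma measurable_density_integrand (g : R -> \bar R) : measurable_fun setT g ->
  measurable_fun (`]0%R, +oo[%classic : set R) (fun t => g t * (t^-1)%:E).
Proof.
move=> mg; apply: (eq_measurable_fun (fun t => g t * (t `^ (-1))%:E)).
  by move=> t; rewrite inE /= in_itv /= andbT => t0; rewrite powR_inv1// ltW.
apply: measurable_funTS; apply: emeasurable_funM => //.
by apply/measurable_EFinP; exact: measurable_powR.
Qed.

(** The embedding of L^{p,q} into L^{p,oo}: as the rearrangement decreases, its
    value at t is controlled by the integral over [t/2, t]. *)
Lemma lorentz_density_le t : (0 < t)%R ->
  lorentz_density t <= (2 * 2 `^ (p^-1 * q))%:E * lorentz_power.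
Proof.
move=> t0; pose D : set R := `[(t / 2)%R, t]%classic.
have mD : measurable D by exact: measurable_itv.
have DT : D `<=` `]0%R, +oo[%classic.
  move=> s; rewrite /D /= !in_itv /= andbT => /andP[ts _]; apply: lt_le_trans ts.
  exact: divr_gt0.
have c0 : (0 <= 2 `^ (p^-1 * q) :> R)%R by exact: powR_ge0.
have lamD : lambda D = (t / 2)%:E.
  rewrite lebesgue_measure_itv /= lte_fin ltr_pdivrMr// ltr_pMr// ltr1n.
  by rewrite -EFinB; congr EFin; field.
have step s : D s -> lorentz_density t * (t^-1)%:E <=
    (2 `^ (p^-1 * q))%:E * (lorentz_density s * (s^-1)%:E).
  move=> Ds; have s0 : (0 < s)%R by have := DT _ Ds; rewrite /= in_itv /= andbT.
  move: Ds; rewrite /D /= in_itv /= => /andP[ts st].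
  rewrite muleA; apply: lee_pmul; 
    rewrite ?lee_fin ?invr_ge0 ?(ltW t0) ?lorentz_density_ge0//; last first.
    by rewrite lef_pV2 ?posrE.
  rewrite /lorentz_density powRrM -(poweR_EFin (2 `^ p^-1)) -poweRM
    ?mule_ge0 ?lee_fin ?powR_ge0 ?rearrangement_ge0//.
  have r0 u : 0 <= (u `^ p^-1)%:E * rearrangement mu f u.
    by rewrite mule_ge0 ?lee_fin ?powR_ge0 ?rearrangement_ge0.
  apply: gt0_ler_poweR; rewrite ?in_itv /= ?leey ?andbT ?(ltW q0)//.
    by rewrite mule_ge0 ?lee_fin ?powR_ge0.
  rewrite muleA; apply: lee_pmul; rewrite ?lee_fin ?powR_ge0 ?rearrangement_ge0//.
    rewrite -powRM ?(ltW s0)//; apply: ge0_ler_powR;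
      rewrite ?nnegrE ?invr_ge0 ?(ltW p0) ?(ltW t0)//.
      by rewrite mulr_ge0// ltW.
    by rewrite mulrC -ler_pdivrMr.
  exact: rearrangement_nonincreasing.
have md := measurable_density_integrand measurable_lorentz_density.
have i0 s : D s -> 0 <= lorentz_density s * (s^-1)%:E.
  move=> /DT /=; rewrite in_itv /= andbT => s0.
  by rewrite mule_ge0 ?lorentz_density_ge0// lee_fin invr_ge0 ltW.
have : lorentz_density t * (t^-1)%:E * (t / 2)%:E <=
    (2 `^ (p^-1 * q))%:E * lorentz_power.
  rewrite -lamD -[leLHS]integral_cst//.
  apply: (@le_trans _ _ (\int[lambda]_(s in D)
      ((2 `^ (p^-1 * q))%:E * (lorentz_density s * (s^-1)%:E)))).
    apply: ge0_le_integral => //.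
    - by move=> s _ /=; rewrite mule_ge0 ?lorentz_density_ge0// lee_fin invr_ge0 ltW.
    - by apply: measurable_funeM; exact: measurable_funS md.
  rewrite ge0_integralZl ?lee_fin//; last exact: measurable_funS md.
  apply: lee_wpmul2l; first by rewrite lee_fin.
  apply: ge0_subset_integral => //; move=> s; rewrite /= in_itv /= andbT => s0.
  by rewrite mule_ge0 ?lorentz_density_ge0// lee_fin invr_ge0 ltW.
rewrite -muleA -EFinM (_ : (t^-1 * (t / 2) = 2^-1)%R); last by field; rewrite gt_eqF.
move=> H; rewrite EFinM -muleA.
apply: (le_trans _ (lee_wpmul2l _ H)); last by rewrite lee_fin.
by rewrite muleCA -EFinM mulfV ?mule1.
Qed.

(** H is the sum over n of w^n (phi(2^n t) + phi(2^(-n) t)), phi being the Lorentz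
    density.  It dominates w^|k| phi(2^k t) because each term of a nonnegative
    series is at most its sum, and its integral is that of phi times a geometric
    series, by dilation invariance. *)
Lemma dyadic_majorant_series (w : R) : (0 < w)%R -> (w < 1)%R -> lorentz_power < +oo ->
  exists H : R -> R,
    [/\ measurable_fun setT H, (forall t, (0 <= H t)%R),
      (forall t n, (0 < t)%R ->
         (w ^+ n)%:E * lorentz_density (2 ^+ n * t)%R <= (H t)%:E /\
         (w ^+ n)%:E * lorentz_density (2^-1 ^+ n * t)%R <= (H t)%:E),
      (forall t, (0 < t)%R -> (H t)%:E <=
         (2 * (2 * 2 `^ (p^-1 * q)) * (1 - w)^-1)%:E * lorentz_power) &
      \int[lambda]_(t in `]0%R, +oo[) (H t * t^-1)%:E <= (2 * (1 - w)^-1)%:E * lorentz_power].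
Proof.
move=> w0 w1 Ifin.
pose phi := lorentz_density; pose E : R := (2 * 2 `^ (p^-1 * q))%R.
have E0 : (0 <= E)%R by rewrite mulr_ge0 ?powR_ge0.
have I0 : 0 <= lorentz_power.
  apply: integral_ge0 => t; rewrite /= in_itv /= andbT => t0.
  by rewrite mule_ge0 ?lorentz_density_ge0// lee_fin invr_ge0 ltW.
have wn0 n : (0 <= w ^+ n)%R by rewrite exprn_ge0// ltW.
have d0 : (0 < 1 - w)%R by rewrite subr_gt0.
pose u (n : nat) (t : R) := (w ^+ n)%:E * (phi (2 ^+ n * t)%R + phi (2^-1 ^+ n * t)%R).
have u0 n t : 0 <= u n t.
  by rewrite mule_ge0 ?lee_fin// adde_ge0// lorentz_density_ge0.
have mphi (c : R) : measurable_fun setT (fun t : R => phi (c * t)%R).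
  exact: (measurableT_comp measurable_lorentz_density (mulrl_measurable c)).
have mu_ n : measurable_fun setT (u n) by apply: measurable_funeM; exact: emeasurable_funD.
pose S t := \sum_(n <oo) u n t.
have S0 t : 0 <= S t by exact: nneseries_ge0.
have mS : measurable_fun setT S by exact: ge0_emeasurable_sum.
have geo (x : \bar R) (v : (\bar R)^nat) : 0 <= x -> (forall n, 0 <= v n) ->
    (forall n, v n <= (w ^+ n)%:E * x) -> \sum_(n <oo) v n <= ((1 - w)^-1)%:E * x.
  move=> x0 v0 vx; apply: lime_le; first exact: is_cvg_nneseries.
  apply: nearW => n; apply: (@le_trans _ _ (\sum_(0 <= i < n) (w ^+ i)%:E * x)).
    exact: lee_sum.
  rewrite -ge0_sume_distrl; last by move=> i _; rewrite lee_fin.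
  apply: lee_wpmul2r => //; rewrite sumEFin lee_fin big_mkord.
  by apply: sum_geometric_le => //; exact: ltW.
have pos2 n t : (0 < t)%R -> (0 < 2 ^+ n * t :> R)%R by move=> t0; rewrite mulr_gt0// exprn_gt0.
have posV n t : (0 < t)%R -> (0 < 2^-1 ^+ n * t :> R)%R.
  by move=> t0; rewrite mulr_gt0// exprn_gt0// invr_gt0.
have Sle t : (0 < t)%R -> S t <= (2 * E * (1 - w)^-1)%:E * lorentz_power.
  move=> t0; rewrite mulrC EFinM -muleA; apply: geo => //.
    by rewrite mule_ge0// lee_fin mulr_ge0.
  move=> n; apply: lee_wpmul2l; first by rewrite lee_fin.
  rewrite mulr2n mulrDl mul1r EFinD ge0_muleDl ?lee_fin//.
  by apply: leeD; apply: lorentz_density_le; [exact: pos2|exact: posV].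
have Sfin t : (0 < t)%R -> S t \is a fin_num.
  move=> t0; rewrite ge0_fin_numE//; apply: (le_lt_trans (Sle t t0)).
  by rewrite lte_mul_pinfty// lee_fin !mulr_ge0 ?invr_ge0// ltW.
have uS n t : u n t <= S t.
  apply: le_trans (nneseries_lim_ge n.+1 _) => //.
  by rewrite big_nat_recr//= leeDr// sume_ge0.
exists (fine \o S); split.
- exact: measurableT_comp.
- by move=> t; rewrite /= fine_ge0.
- move=> t n t0; rewrite /= fineK ?Sfin//; split; apply: le_trans (uS n t);
    (apply: lee_wpmul2l; first by rewrite lee_fin).
  + by rewrite leeDl// lorentz_density_ge0.
  + by rewrite leeDr// lorentz_density_ge0.
- by move=> t t0; rewrite /= fineK ?Sfin//; exact: Sle.
rewrite [leLHS](_ : _ = \int[lambda]_(t in `]0%R, +oo[)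
    \sum_(n <oo) (u n t * (t^-1)%:E)); last first.
  apply: eq_integral => t; rewrite inE /= in_itv /= andbT => t0.
  rewrite EFinM fineK ?Sfin// muleC -nneseriesZl//.
  by apply: eq_eseriesr => n _; rewrite muleC.
have mint g : measurable_fun setT g ->
    measurable_fun (`]0%R, +oo[%classic : set R) (fun t => g t * (t^-1)%:E).
  exact: measurable_density_integrand.
have pos_inv (g : R -> \bar R) t : (forall t, 0 <= g t) -> `]0%R, +oo[%classic t ->
    0 <= g t * (t^-1)%:E.
  move=> g0; rewrite /= in_itv /= andbT => t0.
  by rewrite mule_ge0// lee_fin invr_ge0 ltW.
rewrite integral_nneseries//; last 2 first.
- by move=> n; exact: mint.
- by move=> n t t0; exact: pos_inv.
rewrite mulrC EFinM -muleA; apply: geo.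
- by rewrite mule_ge0.
- by move=> n; apply: integral_ge0 => t t0; exact: pos_inv.
move=> n; rewrite [leLHS](_ : _ = \int[lambda]_(t in `]0%R, +oo[)
    ((w ^+ n)%:E * (phi (2 ^+ n * t)%R * (t^-1)%:E +
    phi (2^-1 ^+ n * t)%R * (t^-1)%:E))); last first.
  apply: eq_integral => t _; rewrite /u -muleA; congr (_ * _).
  by rewrite ge0_muleDl ?lorentz_density_ge0.
rewrite ge0_integralZl//; last 3 first.
- by apply: emeasurable_funD; exact: mint.
- by move=> t t0; rewrite adde_ge0//; apply: (pos_inv (fun t => phi (_ * t)%R)) => // s;
    exact: lorentz_density_ge0.
- by rewrite lee_fin.
apply: lee_wpmul2l; first by rewrite lee_fin.
rewrite ge0_integralD//; last 4 first.
- by move=> t t0; apply: (pos_inv (fun t => phi (_ * t)%R)) => // s; exact: lorentz_density_ge0.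
- exact: mint.
- by move=> t t0; apply: (pos_inv (fun t => phi (_ * t)%R)) => // s; exact: lorentz_density_ge0.
- exact: mint.
rewrite !ge0_integral_dilation ?exprn_gt0 ?invr_gt0//; try exact: lorentz_density_ge0;
  try exact: measurable_lorentz_density.
by rewrite mulr2n EFinD ge0_muleDl// mul1e.
Qed.

End majorant.

Section lorentz_majorant.
Context {R : realType}.

Lemma two_mul_powR (t a : R) (k : R) : 0 < t ->
  (2 `^ k * t) `^ (- a) = 2 `^ (- a * k) * t `^ (- a).
Proof.
by move=> t0; rewrite powRM ?powR_ge0 ?ltW// -powRrM mulrC [k * _]mulrC mulrC.
Qed.

Lemma scaled_le (s a c : R) (x : \bar R) : 0 < s ->
  ((s `^ a)%:E * x <= c%:E -> x <= (c * s `^ (- a))%:E)%E.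
Proof.
move=> s0; have sa : 0 < s `^ a by exact: powR_gt0.
by rewrite powRN EFinM lee_pdivlMr// muleC.
Qed.

Variables (d : measure_display) (T : measurableType d).
Variable mu : {measure set T -> \bar R}.
Notation lambda := (@lebesgue_measure R).

Lemma lorentz_norm_ge0 p q f : (0 <= lorentz_norm mu p q f)%E.
Proof.
case: q => [q||] //=; first exact: poweR_ge0.
apply: (@le_trans _ _ (((1 : R) `^ p^-1)%:E * rearrangement mu f 1)%E).
  by rewrite mule_ge0 ?rearrangement_ge0// lee_fin powR_ge0.
by apply: ereal_sup_ubound; exists 1 => //=.
Qed.

(** For finite q take the q-th root of the series of [dyadic_majorant_series] with
    ratio w = 2^(-delta q); for q infinite the constant equal to the norm is
    enough. *)
Lemma lorentz_majorant (p delta : R) (q : \bar R) :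
  0 < p -> 0 < delta -> (0 < q)%E ->
  exists A, 0 < A /\ forall f, (lorentz_norm mu p q f < +oo)%E ->
  exists B : R -> R,
    [/\ measurable_fun setT B, forall t, 0 <= B t,
      forall t (k : int), 0 < t -> (rearrangement mu f (2 `^ k%:~R * t) <=
        (B t * 2 `^ (delta * `|k%:~R| - p^-1 * k%:~R) * t `^ (- p^-1))%:E)%E,
      forall t, 0 < t -> B t <= A * fine (lorentz_norm mu p q f) &
      forall q', q = q'%:E ->
        (\int[lambda]_(t in `]0%R, +oo[) (B t `^ q' * t^-1)%:E <=
          (A * fine (lorentz_norm mu p q f) `^ q')%:E)%E].
Proof.
move=> p0 delta0.
have one_le (u : R) : 0 <= u -> 1 <= 2 `^ u.
  by move=> u0; have := ler_powR (ler1n R 2) u0; rewrite powRr0.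
have reduce f (B : R -> R) : (forall t (k : int), 0 < t ->
    (((2 `^ k%:~R * t) `^ p^-1)%:E * rearrangement mu f (2 `^ k%:~R * t) <=
     (B t * 2 `^ (delta * `|k%:~R|))%:E)%E) ->
  forall t (k : int), 0 < t -> (rearrangement mu f (2 `^ k%:~R * t) <=
        (B t * 2 `^ (delta * `|k%:~R| - p^-1 * k%:~R) * t `^ (- p^-1))%:E)%E.
  move=> H t k t0; have := H t k t0 => /scaled_le.
  rewrite mulr_gt0 ?powR_gt0// => /(_ isT) /le_trans; apply.
  by rewrite two_mul_powR// powRD ?pnatr_eq0 ?implybT// mulNr !mulrA.
case: q => [q||] //; last first.
  move=> _; exists 1; split => // f Nfin.
  have N0 := lorentz_norm_ge0 p +oo f.
  have Nnum : lorentz_norm mu p +oo f \is a fin_num by rewrite ge0_fin_numE.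
  exists (fun=> fine (lorentz_norm mu p +oo f)); split => //.
  - by move=> t; exact: fine_ge0.
  - apply: (reduce _ (fun=> _)) => t k t0.
    apply: (@le_trans _ _ (lorentz_norm mu p +oo f)).
      by apply: ereal_sup_ubound; exists (2 `^ k%:~R * t) => //=; rewrite mulr_gt0// powR_gt0.
    rewrite -[leLHS]fineK// lee_fin ler_peMr ?fine_ge0//.
    by apply: one_le; rewrite mulr_ge0// ltW.
  - by move=> t _; rewrite mul1r.
rewrite lte_fin => q0.
pose w : R := 2 `^ (- (delta * q)).
have w0 : 0 < w by exact: powR_gt0.
have w1 : w < 1.
  by rewrite /w /powR gt_eqF// expR_lt1 nmulr_rlt0 ?ln_gt0 ?ltr1n// oppr_lt0 mulr_gt0.
pose c : R := 2 * (2 * 2 `^ (p^-1 * q)) * (1 - w)^-1.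
pose c' : R := 2 * (1 - w)^-1.
have d0 : 0 < 1 - w by rewrite subr_gt0.
have c0 : 0 < c by rewrite !mulr_gt0 ?invr_gt0 ?powR_gt0.
have c'0 : 0 < c' by rewrite !mulr_gt0 ?invr_gt0.
exists (c `^ q^-1 + c'); split; first by rewrite addr_gt0// powR_gt0.
move=> f; rewrite lorentz_normE => Nfin.
have Ifin : (lorentz_power mu f p q < +oo)%E.
  by apply: lty_poweRy Nfin; rewrite gt_eqF// invr_gt0.
have I0 : (0 <= lorentz_power mu f p q)%E.
  apply: integral_ge0 => t; rewrite /= in_itv /= andbT => t0.
  by rewrite mule_ge0 ?lorentz_density_ge0// lee_fin invr_ge0 ltW.
have [H [mH H0 Hphi Hle Hint]] := dyadic_majorant_series p0 q0 w0 w1 Ifin.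
have [I IE] : exists I : R, lorentz_power mu f p q = I%:E.
  by exists (fine (lorentz_power mu f p q)); rewrite fineK// ge0_fin_numE.
rewrite IE poweR_EFin /=; rewrite IE in I0 Hle Hint.
rewrite lee_fin in I0.
have qV : q^-1 * q = 1 by rewrite mulVf// gt_eqF.
have qV0 : 0 <= q^-1 by rewrite invr_ge0 ltW.
exists (fun t => H t `^ q^-1); split.
- exact: (measurableT_comp (measurable_powR _)).
- by move=> t; exact: powR_ge0.
- apply: reduce => t k t0.
  have root s (n : nat) :
      (lorentz_density mu f p q s <= (2 `^ (delta * n%:R * q))%:E * (H t)%:E)%E ->
      (((s `^ p^-1)%:E * rearrangement mu f s) <= (H t `^ q^-1 * 2 `^ (delta * n%:R))%:E)%E.
    move=> Hs.
    have b0 : (0 <= (s `^ p^-1)%:E * rearrangement mu f s)%E.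
      by rewrite mule_ge0 ?rearrangement_ge0// lee_fin powR_ge0.
    rewrite -[leLHS]poweRe1// -(mulfV (lt0r_neq0 q0)) poweRrM -/(lorentz_density mu f p q s).
    apply: (@le_trans _ _ (((2 `^ (delta * n%:R * q))%:E * (H t)%:E) `^ q^-1)%E).
      apply: gt0_ler_poweR => //; rewrite in_itv /= leey andbT ?lorentz_density_ge0//.
      by rewrite mule_ge0 ?lee_fin ?powR_ge0 ?H0//.
    by rewrite -EFinM poweR_EFin powRM ?powR_ge0// -powRrM -mulrA mulfV ?mulr1 1?mulrC ?gt_eqF.
  have wE (n : nat) : 2 `^ (delta * n%:R * q) = (w ^+ n)^-1.
    by rewrite /w -powR_mulrn ?powR_ge0// -powRrM -powRN; congr (_ `^ _); ring.
  have wn n : 0 < w ^+ n by rewrite exprn_gt0.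
  have fin (n : nat) s : ((w ^+ n)%:E * lorentz_density mu f p q s <= (H t)%:E)%E ->
      (lorentz_density mu f p q s <= (2 `^ (delta * n%:R * q))%:E * (H t)%:E)%E.
    by move=> h; rewrite wE [leRHS]muleC lee_pdivlMr// muleC.
  case: k => [n|n].
    rewrite -pmulrn powR_mulrn// normr_nat; apply: root; apply: fin.
    by have [] := Hphi t n t0.
  rewrite NegzE mulrNz powRN -pmulrn powR_mulrn// normrN normr_nat -exprVn.
  by apply: root; apply: fin; have [] := Hphi t n.+1 t0.
- move=> t t0; apply: (@le_trans _ _ (c `^ q^-1 * I `^ q^-1)).
    rewrite -powRM ?(ltW c0)//; apply: ge0_ler_powR; rewrite ?nnegrE//.
      by rewrite mulr_ge0// ltW.
    by have := Hle t t0; rewrite -EFinM lee_fin.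
  by apply: ler_wpM2r; rewrite ?powR_ge0// lerDl ltW.
move=> q' [<-].
under eq_integral do rewrite -powRrM qV powRr1//.
apply: (le_trans Hint); rewrite -EFinM lee_fin -powRrM qV powRr1//.
by apply: ler_wpM2r => //; rewrite lerDr powR_ge0.
Qed.

End lorentz_majorant.

(** * Holder's inequality with Lorentz majorants *)

Section holder.
Context {R : realType}.

(** With S the weighted mean, ln (x_j / S) <= x_j / S - 1, and the weighted sum of
    the right-hand sides is zero. *)
Lemma weighted_amgm (J : finType) (w x : J -> R) :
  (forall j, 0 <= w j) -> \sum_j w j = 1 -> (forall j, 0 <= x j) ->
  \prod_j x j `^ w j <= \sum_j w j * x j.
Proof.
move=> w0 w1 x0; pose S := \sum_j w j * x j.
have S0 : 0 <= S by apply: sumr_ge0 => j _; rewrite mulr_ge0.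
have [/existsP[j /andP[wj /eqP xj]]|/existsPn Hj] :=
    boolP [exists j, (w j != 0) && (x j == 0)].
  by rewrite (bigD1 j)//= xj powR0// mul0r.
have Spos : 0 < S.
  rewrite lt_neqAle S0 andbT eq_sym; apply/negP => /eqP SE.
  have w00 j : w j = 0.
    apply/eqP; apply: contraT => wj; have := Hj j; rewrite wj /= => xj.
    have : w j * x j <= S by rewrite /S (bigD1 j)//= lerDl sumr_ge0// => i _; rewrite mulr_ge0.
    by rewrite SE leNgt mulr_gt0// lt_neqAle eq_sym ?wj ?xj ?w0 ?x0.
  by move: w1; rewrite big1// => /eqP; rewrite eq_sym oner_eq0.
have xS j : x j `^ w j <= S `^ w j * expR (w j * (x j / S - 1)).
  have [wj|wj] := eqVneq (w j) 0; first by rewrite wj !powRr0 mul0r expR0 mulr1.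
  have xj : 0 < x j by have := Hj j; rewrite wj /= lt_neqAle eq_sym x0 andbT.
  rewrite -{1}(divfK (lt0r_neq0 Spos) (x j)) mulrC powRM ?divr_ge0//.
  apply: ler_wpM2l; first exact: powR_ge0.
  rewrite /powR gt_eqF ?divr_gt0// ler_expR; apply: ler_wpM2l => //.
  have xS0 : 0 < x j / S by exact: divr_gt0.
  by have := @le_ln1Dx R (x j / S - 1); rewrite (_ : 1 + _ = x j / S); [apply; lra|ring].
apply: (@le_trans _ _ (\prod_j (S `^ w j * expR (w j * (x j / S - 1))))).
  by apply: ler_prod => j _; rewrite powR_ge0 xS.
rewrite big_split /= prod_powR// w1 powRr1// -expR_sum.
rewrite (_ : \sum_j _ = 0) ?expR0 ?mulr1//.
under eq_bigr do rewrite mulrBr mulr1 mulrA.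
by rewrite sumrB w1 -mulr_suml divff ?subrr// gt_eqF.
Qed.

Definition inv_exponent (q : \bar R) : R := if q is q'%:E then q'^-1 else 0.

Lemma inv_exponentE (q : \bar R) : (0 < q)%E -> (q^-1 = (inv_exponent q)%:E)%E.
Proof. by case: q => [q||]//=; rewrite lte_fin => q0; rewrite inver gt_eqF. Qed.

Variables (d : measure_display) (T : measurableType d).
Variable mu : {measure set T -> \bar R}.
Notation lambda := (@lebesgue_measure R).

(** Normalise by the norms N_j.  Factors with q_j infinite are bounded by a
    constant; to the others the weighted mean inequality applies with weights
    q / q_j, which sum to 1, and bounds the q-th power of the product by a
    combination of the B_j^(q_j) / N_j^(q_j), all of bounded integral. *)
Lemma lorentz_norm_product_le (J : finType) (p : R) (q : \bar R) (qs : J -> \bar R)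
    (A : J -> R) (C : R) :
  0 < p -> 0 < C -> (forall j, 0 < A j) -> (0 < q)%E -> (forall j, (0 < qs j)%E) ->
  inv_exponent q = \sum_j inv_exponent (qs j) ->
  exists D, 0 < D /\ forall (N : J -> R) (B : J -> R -> R) (F : T -> R[i]),
    (forall j, 0 <= N j) ->
    (forall j, measurable_fun setT (B j)) -> (forall j t, 0 <= B j t) ->
    (forall j t, 0 < t -> B j t <= A j * N j) ->
    (forall j q', qs j = q'%:E ->
      (\int[lambda]_(t in `]0%R, +oo[) (B j t `^ q' * t^-1)%:E <=
       (A j * N j `^ q')%:E)%E) ->
    (forall t, 0 < t -> (rearrangement mu F t <=
       (C * \prod_j B j t * t `^ (- p^-1))%:E)%E) ->
    (lorentz_norm mu p q F <= (D * \prod_j N j)%:E)%E.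
Proof.
move=> p0 C0 A0 + qs0.
have dens F t (b : R) : 0 < t -> (rearrangement mu F t <= (b * t `^ (- p^-1))%:E)%E ->
    ((t `^ p^-1)%:E * rearrangement mu F t <= b%:E)%E.
  by move=> t0; rewrite powRN EFinM lee_pdivlMr ?powR_gt0// muleC.
case: q => [q||] //.
  rewrite lte_fin /= => q0 qE.
  pose w j := q * inv_exponent (qs j).
  have w1 : \sum_j w j = 1 by rewrite -mulr_sumr -qE mulfV// gt_eqF.
  have w0 j : 0 <= w j.
    rewrite mulr_ge0 ?(ltW q0)//; have := qs0 j; case: (qs j) => [r||]//=.
    by rewrite lte_fin => r0; rewrite ltW// invr_gt0.
  (* the weight is zero when q_j is infinite, and M_j is the bound of that factor *)
pose M j := if qs j is _%:E then 1 else A j `^ q.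
  have M0 j : 0 < M j by rewrite /M; case: (qs j) => *; rewrite ?powR_gt0.
  pose E := \prod_j M j * \sum_j w j * A j.
  have E0 : 0 <= E.
    rewrite mulr_ge0 ?prodr_ge0// => [j _|]; first exact: ltW.
    by apply: sumr_ge0 => j _; rewrite mulr_ge0// ltW.
  exists (C * (E + 1) `^ q^-1); split.
    by rewrite mulr_gt0// powR_gt0// ltr_wpDl.
  move=> N B F N0 mB B0 BN Bint HF.
  pose x j t := if qs j is r%:E then (B j t * (N j)^-1) `^ r else 0.
  have x0 j t : 0 <= x j t by rewrite /x; case: (qs j) => *; rewrite ?powR_ge0.
  have mx j : measurable_fun setT (EFin \o x j).
    apply/measurable_EFinP; rewrite /x; case: (qs j) => [r||]; try exact: measurable_cst.
    apply: (measurableT_comp (measurable_powR _)); apply: measurable_funM => //.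
  have PN0 : 0 <= \prod_j N j by exact: prodr_ge0.
  have PM0 : 0 <= \prod_j M j by apply: prodr_ge0 => j _; exact: ltW.
  pose K := (C * \prod_j N j) `^ q * \prod_j M j.
  have K0 : 0 <= K by rewrite mulr_ge0 ?powR_ge0.
  have wx0 t : 0 <= \sum_j w j * x j t by apply: sumr_ge0 => j _; rewrite mulr_ge0.
  have point t : 0 < t -> (lorentz_density mu F p q t <= (K * \sum_j w j * x j t)%:E)%E.
    move=> t0; apply: (@le_trans _ _ (((C * \prod_j B j t)%:E `^ q)%E)).
      apply: gt0_ler_poweR; rewrite ?(ltW q0)//.
      - rewrite in_itv /= leey andbT mule_ge0 ?rearrangement_ge0//.
        by rewrite lee_fin powR_ge0.
      - by rewrite in_itv /= leey andbT lee_fin mulr_ge0 ?prodr_ge0// ltW.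
      - exact: (dens _ _ _ t0 (HF t t0)).
    rewrite poweR_EFin lee_fin.
    have [/existsP[j /eqP Nj]|/existsPn Nn0] := boolP [exists j, N j == 0].
      have Bj : B j t = 0.
        by apply/eqP; rewrite eq_le B0 andbT; have := BN j t t0; rewrite Nj mulr0.
      by rewrite (bigD1 j)//= Bj mul0r mulr0 powR0 ?gt_eqF// mulr_ge0.
    have Npos j : 0 < N j by rewrite lt_neqAle eq_sym Nn0 N0.
    rewrite (_ : C * _ = (C * \prod_j N j) * \prod_j (B j t * (N j)^-1)); last first.
      rewrite -mulrA -big_split /=; congr (_ * _); apply: eq_bigr => j _.
      by rewrite mulrCA mulfV ?mulr1// gt_eqF.
    have BN0 j : 0 <= B j t * (N j)^-1 by rewrite divr_ge0.
    rewrite powRM; [|by rewrite mulr_ge0// ltW|exact: prodr_ge0].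
    rewrite -mulrA; apply: ler_wpM2l; first exact: powR_ge0.
    apply: (@le_trans _ _ (\prod_j (M j * x j t `^ w j))).
      rewrite powR_prod//.
      apply: ler_prod => j _; rewrite powR_ge0 /= /M /x /w.
      have := qs0 j; case: (qs j) => [r||]//=; last first.
        move=> _; rewrite mulr0 powRr0 mulr1; apply: ge0_ler_powR;
          rewrite ?nnegrE ?(ltW q0) ?(ltW (A0 _))//.
        by rewrite ler_pdivrMr// BN.
      rewrite lte_fin => r0; rewrite mul1r -powRrM mulrCA mulfV ?mulr1// gt_eqF//.
    by rewrite big_split /=; apply: ler_wpM2l => //; exact: weighted_amgm.
  have xint j : (\int[lambda]_(t in `]0%R, +oo[) ((x j t)%:E * (t^-1)%:E) <= (A j)%:E)%E.
    rewrite /x; case qj : (qs j) => [r||].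
    - have r0 : 0 < r by have := qs0 j; rewrite qj.
      have [Nj|Nj] := eqVneq (N j) 0.
        under eq_integral do rewrite Nj invr0 mulr0 powR0 ?gt_eqF// mul0e.
        by rewrite integral0 lee_fin ltW.
      have Npos : 0 < N j by rewrite lt_neqAle eq_sym Nj N0.
      rewrite [leLHS](_ : _ = \int[lambda]_(t in `]0%R, +oo[)
        (((N j)^-1 `^ r)%:E * (B j t `^ r * t^-1)%:E))%E; last first.
        by apply: eq_integral => t _; rewrite powRM ?invr_ge0// -!EFinM; congr EFin; ring.
      rewrite ge0_integralZl//; last 3 first.
      - apply: (@measurable_density_integrand _ (fun t => (B j t `^ r)%:E)).
        apply/measurable_EFinP.
        exact: (measurableT_comp (measurable_powR _)).
      - move=> t; rewrite /= in_itv /= andbT => t0.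
        by rewrite lee_fin mulr_ge0 ?powR_ge0// invr_ge0 ltW.
      - by rewrite lee_fin powR_ge0.
      apply: (@le_trans _ _ (((N j)^-1 `^ r)%:E * (A j * N j `^ r)%:E)%E).
        by apply: lee_wpmul2l; [rewrite lee_fin powR_ge0|exact: Bint].
      by rewrite -EFinM lee_fin mulrCA -powRM ?invr_ge0// mulVf// powR1 mulr1.
    - by under eq_integral do rewrite mul0e; rewrite integral0 lee_fin ltW.
    - by under eq_integral do rewrite mul0e; rewrite integral0 lee_fin ltW.
  have int_le : (lorentz_power mu F p q <= ((C * \prod_j N j) `^ q * E)%:E)%E.
    have mxi j : measurable_fun (`]0%R, +oo[%classic : set R)
        (fun t => ((w j)%:E * ((x j t)%:E * (t^-1)%:E))%E).
      apply: measurable_funeM.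
      exact: (@measurable_density_integrand _ (EFin \o x j) (mx j)).
    have xi0 j t : `]0%R, +oo[%classic t -> (0 <= (w j)%:E * ((x j t)%:E * (t^-1)%:E))%E.
      rewrite /= in_itv /= andbT => t0.
      by rewrite -!EFinM lee_fin mulr_ge0// mulr_ge0// invr_ge0 ltW.
    apply: (@le_trans _ _ (\int[lambda]_(t in `]0%R, +oo[)
        (K%:E * \sum_j ((w j)%:E * ((x j t)%:E * (t^-1)%:E))))%E).
      apply: ge0_le_integral => //.
      - move=> t; rewrite /= in_itv /= andbT => t0.
        by rewrite mule_ge0 ?lorentz_density_ge0// lee_fin invr_ge0 ltW.
      - apply: measurable_density_integrand; exact: measurable_lorentz_density.
      - by apply: measurable_funeM; exact: emeasurable_sum.
      move=> t; rewrite /= in_itv /= andbT => t0.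
      apply: (@le_trans _ _ ((K * \sum_j w j * x j t)%:E * (t^-1)%:E)%E).
        by apply: lee_wpmul2r; [rewrite lee_fin invr_ge0 ltW|exact: point].
      under eq_bigr do rewrite -!EFinM.
      rewrite sumEFin -!EFinM lee_fin -mulrA mulr_suml.
      by under eq_bigr do rewrite -mulrA.
    rewrite ge0_integralZl//; last 2 first.
    - exact: emeasurable_sum.
    - by move=> t t0; apply: sume_ge0 => j _; exact: xi0.
    rewrite ge0_integral_sum//.
    rewrite /E mulrA [leRHS]EFinM; apply: lee_wpmul2l; first by rewrite lee_fin.
    rewrite -sumEFin; apply: lee_sum => j _.
    rewrite ge0_integralZl//; last 3 first.
    - exact: (@measurable_density_integrand _ (EFin \o x j) (mx j)).
    - move=> t; rewrite /= in_itv /= andbT => t0.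
      by rewrite mule_ge0 ?lee_fin// invr_ge0 ltW.
    - by rewrite lee_fin.
    by rewrite [leRHS]EFinM; apply: lee_wpmul2l; rewrite ?lee_fin.
  rewrite -[leLHS]/((lorentz_power mu F p q `^ q^-1)%E);
    apply: (@le_trans _ _ (((C * \prod_j N j) `^ q * E)%:E `^ q^-1)%E).
    have qV0 : 0 <= q^-1 by rewrite invr_ge0 ltW.
    apply: gt0_ler_poweR; rewrite ?in_itv /= ?leey ?andbT//.
      apply: integral_ge0 => t; rewrite /= in_itv /= andbT => t0.
      by rewrite mule_ge0 ?lorentz_density_ge0// lee_fin invr_ge0 ltW.
    by rewrite lee_fin mulr_ge0 ?powR_ge0.
  rewrite poweR_EFin lee_fin powRM ?powR_ge0// -powRrM mulfV ?gt_eqF// powRr1; last first.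
    by rewrite mulr_ge0// ltW.
  rewrite [leRHS]mulrAC; apply: ler_wpM2l; first by rewrite mulr_ge0// ltW.
  apply: ge0_ler_powR; rewrite ?nnegrE ?invr_ge0 ?(ltW q0) ?lerDl ?addr_ge0//.
move=> _ qE; exists (C * \prod_j A j); split.
  by rewrite mulr_gt0// prodr_gt0.
move=> N B F N0 mB B0 BN _ HF /=.
apply: ge_ereal_sup => _ [t /= t0 <-].
apply: le_trans (dens _ _ _ t0 (HF t t0)) _; rewrite lee_fin -mulrA -big_split /=.
apply: ler_wpM2l; first exact: ltW.
by apply: ler_prod => j _; rewrite B0 BN.
Qed.

End holder.

(** * The linear forms of the convolution *)

Section forms.
Local Open Scope ereal_scope.
Context {R : realType} (n m : nat) (alpha : 'I_m -> R).
Notation T := (n.-tuple R).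
Notation mu := (@tuple_lebesgue R n).

(** The index [None] stands for the kernel g. *)
Definition conv_form (j : option 'I_m) (x y : T) : T :=
  if j is Some i then affine (- alpha i) x y else y.

Lemma measurable_affine2 (a : R) :
  measurable_fun setT (fun z : T * T => affine a z.1 z.2).
Proof.
apply/measurable_fun_tnthP => i.
rewrite (_ : _ \o _ = (fun z => tnth z.1 i + a * tnth z.2 i)%R).
  have mt := @measurable_tnth _ R n i.
  apply: measurable_funD; first exact: (measurableT_comp mt (@measurable_fst _ _ T T)).
  apply: measurable_funM; first exact: measurable_cst.
  exact: (measurableT_comp mt (@measurable_snd _ _ T T)).
by apply/funext => z /=; rewrite tnth_mktuple.
Qed.

Lemma measurable_conv_form j : measurable_fun setT (fun z : T * T => conv_form j z.1 z.2).
Proof.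
case: j => [i|]; first exact: (@measurable_affine2 (- alpha i)%R).
exact: (@measurable_snd _ _ T T).
Qed.

Let tonelli_sections (S : set (T * T)) : measurable S ->
  \int[mu]_x mu [set y | S (x, y)] = \int[mu]_y mu [set x | S (x, y)].
Proof.
move=> mS.
have sx x : measurable [set y | S (x, y)].
  have := measurable_xsection x mS; congr (measurable _).
  by apply/seteqP; split => y /=; rewrite /xsection /= inE.
have sy y : measurable [set x | S (x, y)].
  have := measurable_ysection y mS; congr (measurable _).
  by apply/seteqP; split => x /=; rewrite /ysection /= inE.
transitivity (\int[mu]_x fubini_F mu (EFin \o \1_S) x).
  apply: eq_integral => x _; rewrite /fubini_F /=.
  have := integral_indic mu measurableT (sx x); rewrite setIT => <-.
  by apply: eq_integral => y _; rewrite !indicE; congr (_%:R%:E); apply/idP/idP; rewrite !inE.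
rewrite (@indic_fubini_tonelli _ _ _ _ _ mu mu _ mS).
apply: eq_integral => y _; rewrite /fubini_G /=.
have := integral_indic mu measurableT (sy y); rewrite setIT => <-.
by apply: eq_integral => x _; rewrite !indicE; congr (_%:R%:E); apply/idP/idP; rewrite !inE.
Qed.

Let mpre (a : R) (E : set T) : measurable E ->
  measurable [set z : T * T | E (affine a z.1 z.2)].
Proof. by move=> mE; have := measurable_affine2 a measurableT mE; rewrite setTI. Qed.

Let translation (a : R) (y : T) (E : set T) : measurable E ->
  mu [set x | E (affine a x y)] = mu E.
Proof.
move=> mE; pose b : T := [tuple (a * tnth y i)%R | i < n].
rewrite (_ : [set x | _] = affine 1 b @^-1` E).
  by rewrite tuple_lebesgue_affine ?oner_neq0// normr1 invr1 expr1n mul1e.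
apply/seteqP; split => x /=; rewrite (_ : affine a x y = affine 1 b x)//;
  by apply/eq_from_tnth => i; rewrite !tnth_mktuple mul1r addrC.
Qed.

Let integral_const_indic (E : set T) (c : \bar R) (f : T -> \bar R) :
  measurable E -> 0 <= c -> (forall x, E x -> f x = c) -> (forall x, ~ E x -> f x = 0) ->
  \int[mu]_x f x = c * mu E.
Proof.
move=> mE c0 fE fN.
transitivity (\int[mu]_x (c * (\1_E x)%:E)).
  apply: eq_integral => x _; rewrite indicE; have [/set_mem xE|xE] := boolP (x \in E).
    by rewrite fE// mule1.
  by rewrite fN ?mule0//; move: xE; rewrite notin_setE.
rewrite ge0_integralZl//; first by rewrite integral_indic// setIT.
by apply/measurable_EFinP; exact: measurable_indic.
Qed.

(** A common upper bound for the Jacobian factors of the linear maps that occur: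
    the identity, y |-> alpha_i y and y |-> (alpha_i - alpha_j) y. *)
Definition form_cst : R :=
  (1 + \sum_i `|alpha i|^-1 ^+ n + \sum_i \sum_j `|alpha i - alpha j|^-1 ^+ n)%R.

Let e0 (a : R) : (0 <= `|a|^-1 ^+ n)%R.
Proof. by rewrite exprn_ge0// invr_ge0. Qed.

Let s1 : (0 <= \sum_i `|alpha i|^-1 ^+ n)%R.
Proof. exact: sumr_ge0. Qed.

Let s2 : (0 <= \sum_i \sum_j `|alpha i - alpha j|^-1 ^+ n)%R.
Proof. by apply: sumr_ge0 => i _; exact: sumr_ge0. Qed.

Lemma form_cst_ge1 : (1 <= form_cst)%R.
Proof. by rewrite /form_cst; move: s1 s2; lra. Qed.

Hypothesis alpha0 : forall i, alpha i != 0%R.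
Hypothesis alpha_inj : injective alpha.

Lemma conv_form_section j x (E : set T) : measurable E ->
  mu (conv_form j x @^-1` E) <= form_cst%:E * mu E.
Proof.
move=> mE; case: j => [i|] /=; last first.
  rewrite -[leLHS]mul1e; apply: lee_wpmul2r => //.
  by rewrite lee_fin form_cst_ge1.
rewrite tuple_lebesgue_affine ?oppr_eq0// normrN; apply: lee_wpmul2r => //.
rewrite lee_fin /form_cst; have : (`|alpha i|^-1 ^+ n <= \sum_i `|alpha i|^-1 ^+ n)%R.
  by rewrite [leRHS](bigD1 i)//= lerDl sumr_ge0.
by move: s2; lra.
Qed.

(** Tonelli's theorem and translation in x reduce two forms x - alpha_i y and
    x - alpha_j y to the pair z and z + (alpha_i - alpha_j) y; integrating in y
    first then separates the two sets. *)
Lemma conv_form_pair i j (E F : set T) : i != j -> measurable E -> measurable F ->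
  \int[mu]_x mu (conv_form i x @^-1` E `&` conv_form j x @^-1` F) <=
    form_cst%:E * mu E * mu F.
Proof.
move: i j E F => i0 j0 E0 F0.
have one (k : 'I_m) (E F : set T) : measurable E -> measurable F ->
    \int[mu]_x mu (conv_form (Some k) x @^-1` E `&` F) <= form_cst%:E * mu E * mu F.
  move=> mE mF.
  pose S : set (T * T) := [set z | E (affine (- alpha k) z.1 z.2)] `&` (snd @^-1` F).
  have mS : measurable S.
    apply: measurableI; first exact: mpre.
    by rewrite -[X in measurable X]setTI; exact: measurable_snd.
  rewrite [leLHS](tonelli_sections mS).
  rewrite (@integral_const_indic F (mu E))//.
  - apply: lee_wpmul2r => //; rewrite -[leLHS]mul1e; apply: lee_wpmul2r => //.
    by rewrite lee_fin form_cst_ge1.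
  - move=> y Fy; rewrite -[RHS](translation (- alpha k) y mE); congr (mu _).
    by apply/seteqP; split => x /=; [case|].
  - move=> y Fy; rewrite (_ : [set x | _] = set0) ?measure0//.
    by apply/seteqP; split => x //= [].
move: i0 j0 E0 F0 => [i|] [j|] E F // ij mE mF.
- have ijN : (alpha i - alpha j != 0)%R.
    by rewrite subr_eq0; apply: contra ij => /eqP /alpha_inj ->.
  pose a := (alpha i - alpha j)%R.
  pose S : set (T * T) := [set z | E (affine (- alpha i) z.1 z.2)] `&`
    [set z | F (affine (- alpha j) z.1 z.2)].
  have mS : measurable S by apply: measurableI; exact: mpre.
  (* S' is S after the change of variable z = x - alpha_i y *)
pose S' : set (T * T) := (fst @^-1` E) `&` [set z | F (affine a z.1 z.2)].
  have mS' : measurable S'.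
    apply: measurableI; last exact: mpre.
    by rewrite -[X in measurable X]setTI; exact: measurable_fst.
  rewrite [leLHS](tonelli_sections mS).
  have -> : \int[mu]_y mu [set x | S (x, y)] = \int[mu]_y mu [set x | S' (x, y)].
    apply: eq_integral => y _.
    have mSy : measurable [set x | S' (x, y)].
      have := measurable_ysection y mS'; congr (measurable _).
      by apply/seteqP; split => x /=; rewrite /ysection /= inE.
    rewrite -[RHS](translation (- alpha i) y mSy); congr (mu _).
    apply/seteqP; split => x /=; rewrite /S /S' /=;
    by rewrite (_ : affine a _ y = affine (- alpha j) x y)//;
       apply/eq_from_tnth => l; rewrite !tnth_mktuple /a; ring.
  rewrite -(tonelli_sections mS').
  rewrite (@integral_const_indic E ((`|a|^-1 ^+ n)%:E * mu F))//.
  + rewrite muleAC; apply: lee_wpmul2r => //; apply: lee_wpmul2r => //.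
    rewrite lee_fin /form_cst.
    have : (`|a|^-1 ^+ n <= \sum_i \sum_j `|alpha i - alpha j|^-1 ^+ n)%R.
      rewrite [leRHS](bigD1 i)//= (bigD1 j)//= -!addrA lerDl addr_ge0 ?sumr_ge0// => k _.
      exact: sumr_ge0.
    by move: s1; lra.
  + by rewrite mule_ge0// lee_fin.
  + move=> x Ex; rewrite -(tuple_lebesgue_affine x ijN mF).
    by congr (mu _); apply/seteqP; split => y /=; [case|].
  + move=> x Ex; rewrite (_ : [set y | _] = set0) ?measure0//.
    by apply/seteqP; split => y //= [].
- exact: (one i E F mE mF).
- under eq_integral do rewrite setIC.
  by rewrite muleAC; exact: (one j F E mF mE).
Qed.

End forms.

(** * Complex functions and their Borel representatives *)

Section complex_functions.
Context {R : realType}.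
Notation Re := complex.Re.
Notation Im := complex.Im.
Notation normc := Normc.normc.

Lemma normr_Re_le (z : R[i]) : `|Re z| <= normc z.
Proof. by case: z => a b /=; rewrite -sqrtr_sqr ler_wsqrtr// lerDl sqr_ge0. Qed.

Lemma normr_Im_le (z : R[i]) : `|Im z| <= normc z.
Proof. by case: z => a b /=; rewrite -sqrtr_sqr ler_wsqrtr// lerDr sqr_ge0. Qed.

Lemma normc_ge0 (z : R[i]) : 0 <= normc z.
Proof. by case: z => a b; exact: sqrtr_ge0. Qed.

Lemma normc_le (a b : R) : normc (Complex a b) <= `|a| + `|b|.
Proof.
rewrite /= -(ger0_norm (_ : 0 <= `|a| + `|b|)) ?addr_ge0// -sqrtr_sqr ler_wsqrtr//.
rewrite sqrrD !real_normK ?num_real// -addrA lerD2l lerDr.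
by rewrite mulrn_wge0 ?mulr_ge0.
Qed.

Lemma normc_prod (I : finType) (z : I -> R[i]) : normc (\prod_i z i) = \prod_i normc (z i).
Proof. by apply: big_morph; [exact: Normc.normcM|exact: Normc.normc1]. Qed.

Lemma cmeasurableM d (T : measurableType d) (f g : T -> R[i]) :
  cmeasurable f -> cmeasurable g -> cmeasurable (fun x => f x * g x).
Proof.
move=> [fR fI] [gR gI]; split.
  rewrite (_ : (fun x => _) = (fun x => Re (f x) * Re (g x) - Im (f x) * Im (g x))).
    by apply: measurable_funB; apply: measurable_funM.
  by apply/funext => x; case: (f x) => a b; case: (g x).
rewrite (_ : (fun x => _) = (fun x => Re (f x) * Im (g x) + Im (f x) * Re (g x))).
  by apply: measurable_funD; apply: measurable_funM.
by apply/funext => x; case: (f x) => a b; case: (g x).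
Qed.

Lemma cmeasurable_prod d (T : measurableType d) (I : finType) (f : I -> T -> R[i]) :
  (forall i, cmeasurable (f i)) -> cmeasurable (fun x => \prod_i f i x).
Proof.
move=> mf; elim: (index_enum I) => [|i s IH].
  by split; under eq_fun do rewrite big_nil; exact: measurable_cst.
have := cmeasurableM (mf i) IH; congr cmeasurable.
by apply/funext => x; rewrite big_cons.
Qed.

Lemma cmeasurable_comp d d' (T : measurableType d) (T' : measurableType d')
    (phi : T -> T') (f : T' -> R[i]) :
  measurable_fun setT phi -> cmeasurable f -> cmeasurable (f \o phi).
Proof.
move=> mphi [fR fI]; split; first exact: (measurableT_comp fR mphi).
exact: (measurableT_comp fI mphi).
Qed.

(** The constant 2 comes from adding the bounds for the real and the imaginary
    part; it also covers the junk values of divergent integrals, for which the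
    right-hand side is infinite. *)
Lemma normc_cintegral_le d (T : measurableType d) (mu : {measure set T -> \bar R})
    (h : T -> R[i]) : cmeasurable h ->
  ((normc (cintegral mu h))%:E <= 2%:E * \int[mu]_y (normc (h y))%:E)%E.
Proof.
move=> mh; set I := (\int[mu]_y _)%E.
have mn := measurable_normc mh.
have part_le (u : T -> R) : measurable_fun setT u ->
    (forall y, `|u y| <= normc (h y)) -> (`|\int[mu]_y u y|%:E <= I)%E.
  move=> mu_ ule; rewrite /Rintegral; set J := (\int[mu]_y _)%E.
  apply: (@le_trans _ _ `|J|%E).
    by case: J => [r||] //=; rewrite ?normr0 ?lee_fin ?leey.
  apply: (le_trans (le_abse_integral _ _ _)) => //; first exact/measurable_EFinP.
  apply: ge0_le_integral => //.
  - by apply: measurableT_comp => //; exact/measurable_EFinP.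
  - exact/measurable_EFinP.
  - by move=> y _; rewrite abse_EFin lee_fin; exact: ule.
apply: (@le_trans _ _ ((`|\int[mu]_y complex.Re (h y)| +
   `|\int[mu]_y complex.Im (h y)|)%:E)%E).
  by rewrite lee_fin; exact: normc_le.
have I0 : (0 <= I)%E by apply: integral_ge0 => y _; rewrite lee_fin normc_ge0.
rewrite EFinD mulr2n EFinD ge0_muleDl// mul1e; apply: leeD; apply: part_le.
- exact: mh.1.
- by move=> y; exact: normr_Re_le.
- exact: mh.2.
- by move=> y; exact: normr_Im_le.
Qed.

End complex_functions.

Section completion_complex.
Local Open Scope ereal_scope.
Context d (T : measurableType d) (R : realType).
Variable mu : {measure set T -> \bar R}.
Hypothesis sfmu : sigma_finite setT mu.
Notation C := (caratheodory_type (mu^*)%mu).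
Notation cmu := (@completed_measure_extension _ T R mu).

Definition vanish_on (N : set T) (h : T -> R[i]) : T -> R[i] :=
  fun x => if x \in N then 0%R else h x.

Lemma completed_cmeasurable_core (I : finType) (h : I -> T -> R[i]) :
  (forall i, @cmeasurable _ C R (h i)) ->
  exists N : set T, [/\ measurable N, mu N = 0 &
    forall i, @cmeasurable _ T R (vanish_on N (h i))].
Proof.
move=> mh.
have HR i := completed_measurable_fun_core sfmu (mh i).1.
have HI i := completed_measurable_fun_core sfmu (mh i).2.
have [NR HNR] := choice HR.
have [NI HNI] := choice HI.
pose M i := NR i `|` NI i.
have mM i : measurable (M i) by apply: measurableU; [have [] := HNR i|have [] := HNI i].
pose N := \big[setU/set0]_(i : I) M i.
have mN : measurable N by exact: bigsetU_measurable.
have MN i : M i `<=` N by rewrite /N (bigD1 i)//=; exact: subsetUl.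
exists N; split => //.
  apply: measure_negligible => //; rewrite /N.
  elim/big_ind: _ => [|A B|i _]; [exact: negligible_set0|exact: negligibleU|].
  apply: negligibleU; apply/negligibleP.
  - by have [] := HNR i.
  - by have [] := HNR i.
  - by have [] := HNI i.
  - by have [] := HNI i.
move=> i; have [_ _ mR] := HNR i; have [_ _ mI] := HNI i.
have patch_patch (k : T -> R) (A : set T) : A `<=` N -> measurable_fun setT (k \_ (~` A)) ->
    measurable_fun setT (k \_ (~` N)).
  move=> AN mk; rewrite (_ : k \_ (~` N) = (k \_ (~` A)) \_ (~` N)).
    by apply/(measurable_restrictT _ _).1 => //; [exact: measurableC|exact: measurable_funTS].
  apply/funext => x; rewrite /patch; case: ifPn => //; rewrite inE => Nx.
  by rewrite mem_set// => Ax; apply: Nx; exact: AN.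
have Nl : NR i `<=` N by apply: subset_trans (MN i); exact: subsetUl.
have Nr : NI i `<=` N by apply: subset_trans (MN i); exact: subsetUr.
split.
  rewrite (_ : (fun x => _) = (fun x => complex.Re (h i x)) \_ (~` N)).
    exact: patch_patch Nl mR.
  by apply/funext => x; rewrite /patch /vanish_on in_setC; case: (x \in N).
rewrite (_ : (fun x => _) = (fun x => complex.Im (h i x)) \_ (~` N)).
  exact: patch_patch Nr mI.
by apply/funext => x; rewrite /patch /vanish_on in_setC; case: (x \in N).
Qed.

Lemma ae_completed_cmeasurable (N : set T) (f g : T -> R[i]) :
  measurable N -> mu N = 0 -> (forall x, ~ N x -> f x = g x) ->
  cmeasurable f -> @cmeasurable _ C R g.
Proof.
move=> mN N0 fg [mR mI]; split.
  apply: (ae_completed_measurable_fun mN N0 (f := fun x => complex.Re (f x))) => // x Nx.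
  by rewrite fg.
apply: (ae_completed_measurable_fun mN N0 (f := fun x => complex.Im (f x))) => // x Nx.
by rewrite fg.
Qed.

End completion_complex.

(** * The convolution operator *)

Section lebesgue_space.
Local Open Scope ereal_scope.
Context {R : realType} (n : nat).
Notation T := (n.-tuple R).
Notation mu := (@tuple_lebesgue R n).
Notation nu := (lebesgue_n R n).

Lemma lebesgue_nE (E : set T) : measurable E -> nu E = mu E.
Proof. exact: (@completedE _ _ _ (product_lebesgue R n)). Qed.

Lemma ge0_integral_lebesgue_n (f : T -> \bar R) :
  measurable_fun setT f -> (forall x, 0 <= f x) -> \int[nu]_x f x = \int[mu]_x f x.
Proof. exact: (@ge0_integral_completed _ _ _ (product_lebesgue R n)). Qed.

Lemma integral_lebesgue_n (f : T -> \bar R) : measurable_fun setT f ->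
  \int[nu]_x f x = \int[mu]_x f^\+ x - \int[mu]_x f^\- x.
Proof.
move=> mf; rewrite integralE; congr (_ - _); apply: ge0_integral_lebesgue_n => //.
- exact: measurable_funepos.
- exact: measurable_funeneg.
Qed.

Lemma euclidean_cmeasurable_core (I : finType) (h : I -> T -> R[i]) :
  (forall i, @cmeasurable _ (euclidean R n) R (h i)) ->
  exists N : set T, [/\ measurable N, mu N = 0 &
    forall i, @cmeasurable _ T R (vanish_on N (h i))].
Proof.
exact: (@completed_cmeasurable_core _ _ _ (product_lebesgue R n)
  (@sigma_finite_tuple_lebesgue R n)).
Qed.

Lemma ae_euclidean_cmeasurable (N : set T) (f g : T -> R[i]) :
  measurable N -> mu N = 0 -> (forall x, ~ N x -> f x = g x) ->
  cmeasurable f -> @cmeasurable _ (euclidean R n) R g.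
Proof. exact: (@ae_completed_cmeasurable _ _ _ (product_lebesgue R n)). Qed.

Lemma measurable_fun_euclidean d' (T' : measurableType d') (f : T -> T') :
  measurable_fun setT f -> measurable_fun setT (f : euclidean R n -> T').
Proof. exact: (@measurable_fun_completed _ _ _ (product_lebesgue R n)). Qed.

Lemma ae_euclidean_integral (N : set T) (f g : T -> R) :
  measurable N -> mu N = 0 -> (forall x, ~ N x -> f x = g x) ->
  measurable_fun setT (f : euclidean R n -> R) ->
  measurable_fun setT (g : euclidean R n -> R) ->
  \int[nu]_x (f x)%:E = \int[nu]_x (g x)%:E.
Proof.
move=> mN N0 fg mf mg; apply: ae_eq_integral.
- exact: measurableT.
- exact/measurable_EFinP.
- exact/measurable_EFinP.
exists N; split.
- exact: (@measurable_completed _ _ _ (product_lebesgue R n)).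
- by rewrite -[RHS]N0; exact: lebesgue_nE.
- by move=> x /= /not_implyP[_]; apply: contra_notP => /fg ->.
Qed.

Lemma subscaleE (a : R) (x y : T) : subscale a x y = affine (- a) x y.
Proof. by apply: eq_from_tnth => j; rewrite !tnth_mktuple mulNr. Qed.

End lebesgue_space.

Section convolution.
Local Open Scope ereal_scope.
Context {R : realType} (n m : nat) (alpha : 'I_m -> R).
Notation T := (n.-tuple R).
Notation mu := (@tuple_lebesgue R n).
Notation nu := (lebesgue_n R n).
Notation normc := Normc.normc.
Hypothesis alpha0 : forall i, alpha i != 0%R.
Variables (f : 'I_m -> T -> R[i]) (g : T -> R[i]).

Definition factors (j : option 'I_m) : T -> R[i] := if j is Some i then f i else g.

Hypothesis mh : forall j, @cmeasurable _ (euclidean R n) R (factors j).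

Lemma mconv_integrandE (x y : T) :
  @mconv_integrand R n m alpha f g x y = (\prod_j factors j (conv_form alpha j x y))%R.
Proof.
rewrite big_option /= mulrC /mconv_integrand; congr (_ * _)%R.
by apply: eq_bigr => i _; rewrite subscaleE.
Qed.

(** Replace all factors by Borel functions vanishing on a common null set N.  For
    each fixed x the integrand changes only on the union of the preimages of N
    under the forms, which is null by [conv_form_section].  So all integrals over y
    stay the same, while Tonelli's theorem applies to the new integrand. *)
Lemma mconv_borel : exists v : option 'I_m -> T -> R,
  [/\ forall j, measurable_fun setT (v j),
      forall j z, (0 <= v j z <= normc (factors j z))%R,
      forall x, @cmeasurable _ (euclidean R n) R (@mconv_integrand R n m alpha f g x),
      forall x, \int[nu]_y (normc (@mconv_integrand R n m alpha f g x y))%:E =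
        multilinear mu (conv_form alpha) v x &
      @cmeasurable _ (euclidean R n) R (@mconv R n m alpha f g)].
Proof.
have [N [mN N0 mhN]] := euclidean_cmeasurable_core mh.
pose h j := vanish_on N (factors j).
pose e (z : T * T) := (\prod_j h j (conv_form alpha j z.1 z.2))%R.
have me : cmeasurable e.
  apply: cmeasurable_prod => j; apply: (cmeasurable_comp _ (mhN j)).
  exact: measurable_conv_form.
pose M x := \big[setU/set0]_(j : option 'I_m) (conv_form alpha j x @^-1` N).
have mLx j x : measurable_fun setT (conv_form alpha j x).
  exact: (measurable_fun_pair2 _ (measurable_conv_form alpha j)).
have mpre j x : measurable (conv_form alpha j x @^-1` N).
  by rewrite -[X in measurable X]setTI; exact: mLx.
have mM x : measurable (M x) by exact: bigsetU_measurable.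
have M0 x : mu (M x) = 0.
  apply: measure_negligible => //; rewrite /M.
  elim/big_ind: _ => [|A B|j _]; [exact: negligible_set0|exact: negligibleU|].
  apply/negligibleP => //; apply/eqP; rewrite -measure_le0.
  by rewrite (le_trans (conv_form_section alpha0 _ _ mN))// N0 mule0.
have eE x y : ~ M x y -> e (x, y) = @mconv_integrand R n m alpha f g x y.
  move=> nM; rewrite mconv_integrandE; apply: eq_bigr => j _.
  rewrite /h /vanish_on memNset// => Nj; apply: nM.
  by rewrite /M (bigD1 j)//=; left.
have mex x : cmeasurable (fun y => e (x, y)).
  split; [exact: (measurable_fun_pair2 _ me.1)|exact: (measurable_fun_pair2 _ me.2)].
have mi x : @cmeasurable _ (euclidean R n) R (@mconv_integrand R n m alpha f g x).
  exact: (ae_euclidean_cmeasurable (mM x) (M0 x) (@eE x) (mex x)).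
have part_measurable (part : R[i] -> R) : measurable_fun setT (part \o e) ->
    (forall x, measurable_fun setT
       (part \o (@mconv_integrand R n m alpha f g x) : euclidean R n -> R)) ->
    measurable_fun setT ((fun x => (\int[nu]_y part (@mconv_integrand R n m alpha f g x y))%R)
      : euclidean R n -> R).
  move=> mpe mpi.
  pose P := EFin \o (part \o e).
  have mP : measurable_fun setT P by exact/measurable_EFinP.
  have -> : (fun x => (\int[nu]_y part (@mconv_integrand R n m alpha f g x y))%R) =
      fine \o ((fun x => \int[mu]_y P^\+ (x, y)) \- (fun x => \int[mu]_y P^\- (x, y))).
    apply/funext => x; rewrite /Rintegral /=; congr fine.
    have mPx : measurable_fun setT (fun y => part (e (x, y))).
      exact: (measurable_fun_pair2 _ mpe).
    transitivity (\int[nu]_y (part (e (x, y)))%:E).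
      apply/esym/(ae_euclidean_integral (mM x) (M0 x)).
      - by move=> y /eE ->.
      - exact: measurable_fun_euclidean mPx.
      - exact: mpi.
    rewrite integral_lebesgue_n; last exact/measurable_EFinP.
    by congr (_ - _); apply: eq_integral => y _; rewrite ?funeposE ?funenegE.
  apply: measurable_fun_euclidean; apply: measurableT_comp => //.
  apply: emeasurable_funB.
    apply: (@measurable_fun_fubini_tonelli_F _ _ _ _ _ mu (P^\+)) => //.
    exact: measurable_funepos.
  apply: (@measurable_fun_fubini_tonelli_F _ _ _ _ _ mu (P^\-)) => //.
  exact: measurable_funeneg.
exists (fun j z => normc (h j z)); split.
- by move=> j; apply: measurable_normc; exact: mhN.
- move=> j z; rewrite normc_ge0 /= /h /vanish_on; case: ifP => // _.
  by rewrite Normc.normc0 normc_ge0.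
- exact: mi.
- move=> x; have mnex := measurable_normc (mex x).
  transitivity (\int[nu]_y (normc (e (x, y)))%:E).
    apply/esym/(ae_euclidean_integral (mM x) (M0 x)).
    + by move=> y /eE ->.
    + exact: measurable_fun_euclidean mnex.
    + exact: measurable_normc (mi x).
  rewrite ge0_integral_lebesgue_n.
  + by apply: eq_integral => y _; rewrite /e normc_prod.
  + exact/measurable_EFinP.
  + by move=> y; rewrite lee_fin normc_ge0.
split.
- apply: (part_measurable (@complex.Re R)); first exact: me.1.
  by move=> x; exact: (mi x).1.
- apply: (part_measurable (@complex.Im R)); first exact: me.2.
  by move=> x; exact: (mi x).2.
Qed.

End convolution.

(** * The theorem *)

Theorem theorem2p1 (R : realType) (n m : nat) (alpha : 'I_m -> R)
    (ps : 'I_m -> R) (r p : R) (qs : 'I_m -> \bar R) (s q : \bar R) :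
  (0 < n)%N -> (0 < m)%N ->
  (forall i, alpha i != 0) -> injective alpha ->
  (forall i, 1 < ps i) -> 1 < r ->
  1 < \sum_(i < m) (ps i)^-1 + r^-1 < 2 ->
  1 < p -> p^-1 = \sum_(i < m) (ps i)^-1 + r^-1 - 1 ->
  (forall i, (0 < qs i)%E) -> (0 < s)%E ->
  (0 < q)%E -> (q^-1 = \sum_(i < m) (qs i)^-1 + s^-1)%E ->
  exists C : R, 0 < C /\
    forall (f : 'I_m -> euclidean R n -> R[i]) (g : euclidean R n -> R[i]),
      (forall i, lorentz (lebesgue_n R n) (ps i) (qs i) (f i)) ->
      lorentz (lebesgue_n R n) r s g ->
      [/\ \forall x \ae lebesgue_n R n,
            cintegrable (lebesgue_n R n) (mconv_integrand alpha f g x),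
          cmeasurable (mconv alpha f g) &
          (lorentz_norm (lebesgue_n R n) p q (mconv alpha f g) <=
           C%:E *
           (\prod_(i < m) lorentz_norm (lebesgue_n R n) (ps i) (qs i) (f i)) *
           lorentz_norm (lebesgue_n R n) r s g)%E].
Proof.
move=> _ _ alpha0 alpha_inj ps1 r1 _ p1 pE qs0 s0 q0 qE.
pose J := option 'I_m.
pose pp (j : J) := if j is Some i then ps i else r.
pose qq (j : J) := if j is Some i then qs i else s.
pose th (j : J) := (pp j)^-1.
have pp1 j : 1 < pp j by case: j => [i|] /=.
have qq0 j : (0 < qq j)%E by case: j => [i|] /=.
have p0 : 0 < p by exact: lt_trans p1.
have pp0 j : 0 < pp j by exact: lt_trans (pp1 j).
have th_sum : \sum_j th j + (1 - p^-1) = 2 by rewrite big_option /= pE /th /=; lra.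
have qqE : inv_exponent q = \sum_j inv_exponent (qq j).
  apply: EFin_inj; rewrite -inv_exponentE// qE big_option /= addeC EFinD.
  rewrite (inv_exponentE s0) -sumEFin; congr (_ + _)%E.
  by apply: eq_bigr => i _; rewrite inv_exponentE.
have [|eps [eps0 epsE]] := @finite_lower_bound R (option J)
  (fun o => let t := if o is Some j then th j else 1 - p^-1 in Num.min t (1 - t)).
  have inv01 (u : R) : 1 < u -> 0 < u^-1 < 1.
    by move=> u1; rewrite invr_gt0 invf_lt1 ?u1 (lt_trans ltr01 u1).
  case=> [j|]; rewrite lt_min.
    by have /andP[a b] := inv01 _ (pp1 j); apply/andP; split; rewrite /th; lra.
  by have /andP[a b] := inv01 _ p1; apply/andP; split; lra.
have th_eps j : eps <= th j <= 1 - eps.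
  by have := epsE (Some j); rewrite /= le_min => /andP[-> ?]; lra.
have th0_eps : eps <= 1 - p^-1 <= 1 - eps.
  by have := epsE None; rewrite /= le_min => /andP[-> ?]; lra.
have J0 : 0 < #|{: J}|%:R :> R by rewrite ltr0n; apply/card_gt0P; exists None.
pose delta := eps / (2 * #|{: J}|%:R).
have delta0 : 0 < delta by rewrite divr_gt0// mulr_gt0.
have delta_eps : 2 * delta * #|{: J}|%:R <= eps.
  by rewrite /delta le_eqVlt; apply/orP; left; apply/eqP; field; rewrite gt_eqF.
have HA j := @lorentz_majorant R _ _ (lebesgue_n R n) (pp j) delta (qq j) (pp0 j) delta0 (qq0 j).
have [A {}HA] := choice HA.
have A0 j : 0 < A j by have [] := HA j.
pose c : R := multilinear_cst J (form_cst n alpha) delta.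
have K0 : 0 <= form_cst n alpha :> R by apply: le_trans (form_cst_ge1 n alpha).
have c0 : 0 <= c.
  rewrite /c /multilinear_cst !mulr_ge0// exprn_ge0// mulr_ge0// invr_ge0 subr_ge0.
  exact/ltW/ratio_lt1.
pose C := 2 * c + 1.
have C0 : 0 < C by rewrite /C ltr_wpDl// mulr_ge0.
have [D [D0 HD]] := lorentz_norm_product_le (lebesgue_n R n) p0 C0 A0 q0 qq0 qqE.
exists D; split; first exact: D0.
move=> f g Hf Hg.
pose h := factors f g.
have Hh j : lorentz (lebesgue_n R n) (pp j) (qq j) (h j) by case: j => [i|] /=.
have mh j : @cmeasurable _ (euclidean R n) R (h j) by have [] := Hh j.
have [v [mv vh mint intG mF]] := mconv_borel alpha0 mh.
pose G x := multilinear (@tuple_lebesgue R n) (conv_form alpha) v x.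
have v0 j z : 0 <= v j z by have /andP[] := vh j z.
pose N j := fine (lorentz_norm (lebesgue_n R n) (pp j) (qq j) (h j)).
have Nfin j : lorentz_norm (lebesgue_n R n) (pp j) (qq j) (h j) \is a fin_num.
  by rewrite ge0_fin_numE ?lorentz_norm_ge0//; have [] := Hh j.
have N0 j : 0 <= N j by rewrite fine_ge0// lorentz_norm_ge0.
have HB j := (HA j).2 (h j) (Hh j).2.
have [B {}HB] := choice HB.
have B0 j t : 0 <= B j t by have [_ + _ _ _] := HB j; apply.
have level_G t : 0 < t -> (@tuple_lebesgue R n [set x |
    ((c * \prod_j B j t * t `^ (1 - p^-1 - 1))%:E < G x)%E] <= t%:E)%E.
  move=> t0; apply: (multilinear_level (measurable_conv_form alpha) K0
    (conv_form_section alpha0) (conv_form_pair alpha_inj) th_sum eps0 th_eps th0_eps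
    delta0 delta_eps mv v0 (fun j => B0 j t) t0) => j k.
  have [_ _ + _ _] := HB j => /(_ t k t0) rB.
  have env0 : 0 <= envelope th delta (fun j => B j t) t j k%:~R.
    by rewrite /envelope !mulr_ge0 ?powR_ge0.
  suff : (lebesgue_n R n [set x | (envelope th delta (fun j => B j t) t j k%:~R < v j x)%R] <=
      (2 `^ k%:~R * t)%:E)%E.
    by rewrite (lebesgue_nE (measurable_superlevel _ (mv j))).
  apply: le_trans (distribution_rearrangement_le (mh j) rB).
  apply: le_measure; rewrite ?inE.
  - apply: (@measurable_completed _ _ _ (product_lebesgue R n)).
    exact: measurable_superlevel (mv j).
  - exact: measurable_superlevel (measurable_normc (mh j)).
  - by move=> x /= /lt_le_trans; apply; have /andP[] := vh j x.
have mG : measurable_fun setT G.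
  exact: (measurable_multilinear _ (measurable_conv_form alpha) mv v0).
have rF t : 0 < t -> (rearrangement (lebesgue_n R n) (mconv alpha f g) t <=
    (C * \prod_j B j t * t `^ (- p^-1))%:E)%E.
  move=> t0; have PB0 : 0 <= \prod_j B j t by exact: prodr_ge0.
  have cB0 : 0 <= c * \prod_j B j t * t `^ (- p^-1) by rewrite mulr_ge0 ?powR_ge0// mulr_ge0.
  apply: rearrangement_le; first by rewrite mulr_ge0 ?powR_ge0// mulr_ge0// ltW.
  have := level_G t t0; rewrite (_ : 1 - p^-1 - 1 = - p^-1); last by ring.
  apply: le_trans.
  rewrite -lebesgue_nE; last first.
    by rewrite -[X in measurable X]setTI; exact: emeasurable_fun_o_infty.
  apply: le_measure; rewrite ?inE.
  - exact: measurable_superlevel (measurable_normc mF).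
  - apply: (@measurable_completed _ _ _ (product_lebesgue R n)).
    by rewrite -[X in measurable X]setTI; exact: emeasurable_fun_o_infty.
  move=> x /= xF; have := normc_cintegral_le (lebesgue_n R n) (mint x).
  rewrite intG -/(G x) -/(mconv alpha f g x) => FG.
  have : ((C * \prod_j B j t * t `^ (- p^-1))%:E < 2%:E * G x)%E.
    by apply: lt_le_trans FG; rewrite lte_fin.
  apply: contraTT; rewrite -!leNgt => Gc.
  apply: (@le_trans _ _ (2%:E * (c * \prod_j B j t * t `^ (- p^-1))%:E)%E).
    exact: lee_wpmul2l.
  rewrite -EFinM lee_fin -subr_ge0 [leRHS](_ : _ = \prod_j B j t * t `^ (- p^-1)).
    by rewrite mulr_ge0 ?powR_ge0.
  by rewrite /C; ring.
have mGoo : measurable [set x | G x = +oo%E].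
  by rewrite -[X in measurable X]setTI; exact: (mG measurableT _ (emeasurable_set1 +oo%E)).
have Goo0 : @tuple_lebesgue R n [set x | G x = +oo%E] = 0%E.
  apply/eqP; rewrite -measure_le0; apply/lee_addgt0Pr => t t0; rewrite add0e.
  apply: le_trans (level_G t t0); apply: le_measure; rewrite ?inE//.
    by rewrite -[X in measurable X]setTI; exact: emeasurable_fun_o_infty.
  by move=> x /= ->; rewrite ltry.
split.
- exists [set x | G x = +oo%E]; split.
  + exact: (@measurable_completed _ _ _ (product_lebesgue R n)).
  + by rewrite -[RHS]Goo0; exact: lebesgue_nE.
  + move=> x /=; apply: contra_notP => /eqP Gfin; split; first exact: mint.
    by rewrite intG lt_neqAle Gfin leey.
- exact: mF.
have Bmeas j : measurable_fun setT (B j) by have [] := HB j.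
have Bbnd j t : 0 < t -> B j t <= A j * N j by have [_ _ _ + _] := HB j; apply.
have Bint j := let: And5 _ _ _ _ X := HB j in X.
apply: le_trans (HD N B (mconv alpha f g) N0 Bmeas B0 Bbnd Bint rF) _.
rewrite EFinM -muleA; apply: lee_wpmul2l; first by rewrite lee_fin ltW.
rewrite big_option /= mulrC EFinM -prodEFin /N /= !fineK; last exact: (Nfin None).
rewrite le_eqVlt; apply/orP; left; apply/eqP; congr (_ * _)%E.
by apply: eq_bigr => i _; rewrite fineK//; exact: (Nfin (Some i)).
Qed.
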